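(* Let $n\ge1$, $\mathbf s\in\mathbb C^n$ and let $\mathbf s'=\sigma(\mathbf s)$ be obtained from $\mathbf s$ by a permutation $\sigma$ of coordinates. (1) If $\mathbf s$ is typical ($s_i+s_j\ne0$ for all $i\ne j$), then $V(\mathbf s)$ is isomorphic as a $W^n$-module to $V(\mathbf s')$ or to $\Pi V(\mathbf s')$. (2) For arbitrary $\mathbf s$, in the Grothendieck group of finite-dimensional $W^n$-modules one has $[V(\mathbf s)]=[V(\mathbf s')]$ or $[V(\mathbf s)]=[\Pi V(\mathbf s')]$.
   Context: $U(\mathfrak h_n)$ is the associative superalgebra generated by odd elements $\xi_1,\dots,\xi_n$ with $\xi_i\xi_j+\xi_j\xi_i=0$ for $i\neq j$, and $x_i=\xi_i^2$ (central); it is the enveloping algebra of the Cartan subalgebra of the queer Lie superalgebra $Q(n)$. $W^n\subset U(\mathfrak h_n)$ is the finite $W$-algebra of $Q(n)$ for the principal even nilpotent element, realized in $U(\mathfrak h_n)$ via the injective Harish-Chandra homomorphism; concretely it is the subalgebra generated by $u_k(0),u_k(1)$ ($1\le k\le n$), the even and odd parts of $\sum_{1\le i_1<\dots<i_k\le n}\prod_{j=1}^{k}(x_{i_j}+(-1)^{k-j}\xi_{i_j})$ (ordered product). For $\mathbf s\in\mathbb C^n$, $V(\mathbf s)$ is a simple $\mathbb Z_2$-graded $U(\mathfrak h_n)$-module on which each $x_i$ acts by $s_i$ (unique up to isomorphism and parity change $\Pi$), regarded as a $W^n$-module by restriction. *)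

(* Defs.v *)
From HB Require Import structures.
From mathcomp Require Import all_boot all_order all_algebra all_fingroup.
From mathcomp Require Import reals complex mpoly.
From Stdlib Require Import ClassicalEpsilon.

Set Implicit Arguments.
Unset Strict Implicit.
Unset Printing Implicit Defensive.

Import GRing.Theory Num.Theory.
Local Open Scope ring_scope.

Section QueerW.
Variables (C : fieldType) (n : nat).

(* U(h_n), in its PBW model: the element  sum_m c_m xi^m  (xi^m the ordered *)
(* monomial xi_1^{m_1} ... xi_n^{m_n}) is stored as the polynomial          *)
(* sum_m c_m 'X^m.  The (noncommutative) product is twisted by the sign     *)
(* coming from xi_i xi_j = - xi_j xi_i (i <> j):                             *)
(*   xi^a xi^b = (-1)^(sum_{j<i} a_i b_j) xi^(a+b).                          *)
Definition Uh := {mpoly C[n]}.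

Definition msign (a b : 'X_{1..n}) : C :=
  (-1) ^+ (\sum_(i < n) \sum_(j < n | (j < i)%N) (a i * b j))%N.

Definition umul (p q : Uh) : Uh :=
  \sum_(a <- msupp p) \sum_(b <- msupp q)
     (p@_a * q@_b * msign a b) *: 'X_[a + b].

Definition xi (i : 'I_n) : Uh := 'X_i.
Definition xx (i : 'I_n) : Uh := umul (xi i) (xi i).

Definition uevenp (u : Uh) : bool := all (fun m => ~~ odd (mdeg m)) (msupp u).
Definition uoddp (u : Uh) : bool := all (fun m => odd (mdeg m)) (msupp u).
Definition upart (e : bool) (u : Uh) : Uh :=
  \sum_(m <- msupp u | odd (mdeg m) == e) u@_m *: 'X_[m].

(* the j-th factor (j = 0..k-1, i.e. paper's j+1) : x_i + (-1)^(k-(j+1)) xi_i *)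
Definition ufactor (k j : nat) (i : 'I_n) : Uh :=
  xx i + ((-1) ^+ (k - j.+1)%N) *: xi i.

Definition uprod (e : seq 'I_n) : Uh :=
  \big[umul/1]_(p <- zip e (iota 0 (size e))) ufactor (size e) p.2 p.1.

(* sum over i_1 < ... < i_k (enum I lists I increasingly) *)
Definition ubig (k : nat) : Uh :=
  \sum_(I : {set 'I_n} | #|I| == k) uprod (enum I).

Definition ugen (k : nat) (e : bool) : Uh := upart e (ubig k).

Inductive inW : Uh -> Prop :=
| inW_gen k e : (1 <= k <= n)%N -> inW (ugen k e)
| inW_one : inW 1
| inW_add u v : inW u -> inW v -> inW (u + v)
| inW_scale (c : C) u : inW u -> inW (c *: u)
| inW_mul u v : inW u -> inW v -> inW (umul u v).

(* Finite-dimensional Z/2-graded modules.  The space is V = V_0 (+) V_1 =   *)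
(* 'rV_(d0 + d1) (row vectors, first d0 coordinates even); an element u     *)
(* acts by v |-> v *m act u, so a left action means                         *)
(*   act (u v) = act v *m act u.                                            *)
Record smod := SMod { d0 : nat; d1 : nat; act : Uh -> 'M[C]_(d0 + d1) }.

Definition even_mx a0 a1 b0 b1 (P : 'M[C]_(a0 + a1, b0 + b1)) : Prop :=
  ursubmx P = 0 /\ dlsubmx P = 0.
Definition odd_mx a0 a1 b0 b1 (P : 'M[C]_(a0 + a1, b0 + b1)) : Prop :=
  ulsubmx P = 0 /\ drsubmx P = 0.

(* M is a (graded) module over the sub-superalgebra A of U(h_n)
   (only the values of act on A matter) *)
Definition is_rep (A : Uh -> Prop) (M : smod) : Prop :=
  [/\ act M 1 = 1%:M,
      forall u v, A u -> A v -> act M (u + v) = act M u + act M v,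
      forall (c : C) u, A u -> act M (c *: u) = c *: act M u &
      forall u v, A u -> A v -> act M (umul u v) = act M v *m act M u] /\
  (forall u, A u -> uevenp u -> even_mx (act M u)) /\
  (forall u, A u -> uoddp u -> odd_mx (act M u)).

Definition Umod (M : smod) : Prop := is_rep (fun _ => True) M.
Definition Wmod (M : smod) : Prop := is_rep inW M.

Definition shom (A : Uh -> Prop) (M N : smod)
    (P : 'M[C]_(d0 M + d1 M, d0 N + d1 N)) : Prop :=
  even_mx P /\ forall u, A u -> act M u *m P = P *m act N u.

Definition siso (A : Uh -> Prop) (M N : smod) : Prop :=
  exists (P : 'M[C]_(d0 M + d1 M, d0 N + d1 N))
         (Q : 'M[C]_(d0 N + d1 N, d0 M + d1 M)),
    [/\ @shom A M N P, P *m Q = 1%:M & Q *m P = 1%:M].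

Definition Pi (M : smod) : smod :=
  @SMod (d1 M) (d0 M) (fun u => let X := act M u in
        block_mx (drsubmx X) (dlsubmx X) (ursubmx X) (ulsubmx X)).

(* simple graded U(h_n)-module: nonzero, and every graded submodule
   S_0 (+) S_1 (S_0 <= V_0, S_1 <= V_1 given as row spaces) is 0 or V *)
Definition Usimple (M : smod) : Prop :=
  (0 < d0 M + d1 M)%N /\
  forall (S0 : 'M[C]_(d0 M)) (S1 : 'M[C]_(d1 M)),
    (forall u, (block_mx S0 0 0 S1 *m act M u <= block_mx S0 0 0 S1)%MS) ->
    \rank (block_mx S0 0 0 S1) = 0%N \/ row_full (block_mx S0 0 0 S1).

Definition is_V (s : 'I_n -> C) (M : smod) : Prop :=
  [/\ Umod M, Usimple M & forall i, act M (xx i) = (s i)%:M].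

Definition typical (s : 'I_n -> C) : Prop :=
  forall i j : 'I_n, i != j -> s i + s j != 0.

(* Grothendieck group of finite-dimensional W^n-modules: the free abelian  *)
(* group on isomorphism classes of W^n-modules modulo [E] - [A] - [B] for  *)
(* every short exact sequence 0 -> A -> E -> B -> 0 (even maps).           *)
Definition Wses (A E B : smod) : Prop :=
  [/\ Wmod A, Wmod E, Wmod B &
   exists (f : 'M[C]_(d0 A + d1 A, d0 E + d1 E))
          (g : 'M[C]_(d0 E + d1 E, d0 B + d1 B)),
     [/\ @shom inW A E f, @shom inW E B g, row_free f, row_full g
       & (f == kermx g)%MS]].

(* coefficient of the isomorphism class of X in the generator [Y] *)
Definition indW (X Y : smod) : int :=
  if excluded_middle_informative (siso inW Y X) then 1 else 0.

Definition K0eq (M N : smod) : Prop :=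
  exists (k : nat) (c : 'I_k -> int) (A E B : 'I_k -> smod),
    (forall t, Wses (A t) (E t) (B t)) /\
    forall X, Wmod X ->
      indW X M - indW X N =
      \sum_(t < k) c t * (indW X (E t) - indW X (A t) - indW X (B t)).

End QueerW.

(* Main.v *)
(* For a family X_i of odd anticommuting operators with X_i^2 = s_i, the
   generators of W^n involve a pair of adjacent operators A = X_i, B = X_(i+1)
   (a = s_i, b = s_(i+1)) only through A + B, A B and a B - b A.  If a + b != 0,
   the pair A' = ((b - a) B + 2 b A) / (a + b), B' = ((a - b) A + 2 a B) / (a + b)
   is again anticommuting, has the squares of A and B exchanged and gives the
   same three combinations: V(s) and V(s') are literally the same W^n-module.
   If b = - a != 0, take the pair (B, - A) instead.  The product of the two
   operators is unchanged and splits the space into two eigenspaces K, Q.  The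
   operator A + B maps Q to K and kills K, while B - A maps K to Q and kills Q,
   so that the two W^n-modules are extensions of Q by K and of K by Q.
   Adjacent transpositions generate the symmetric group, and a simple module
   V(s) is unique up to parity: starting from any homogeneous matrix, one
   averages over X_1, ..., X_n one at a time; when an average vanishes, the
   matrix intertwines X_k up to the sign -1 and is corrected by a partial volume element. *)

Require Import Defs.
From HB Require Import structures.
From mathcomp Require Import all_boot all_order all_algebra all_fingroup.
From mathcomp Require Import reals complex mpoly ssrcomplements ring.
From Stdlib Require Import ClassicalEpsilon.
(* the name act of Defs is shadowed by fingroup *)
Import Defs.

Set Implicit Arguments.
Unset Strict Implicit.
Unset Printing Implicit Defensive.

Import GRing.Theory Num.Theory.
Local Open Scope ring_scope.

(** * Parity of matrices and the algebra U(h_n) *)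

Section Grading.
Variable C : fieldType.

Definition gradmx (a0 a1 : nat) : 'M[C]_(a0 + a1) :=
  block_mx 1%:M 0 0 (- 1%:M).

(** Parity as commutation with the grading involution up to the sign (-1)^e: this form passes
    through products by plain matrix algebra. When 2 is nonzero it is equivalent to [even_mx] and
    [odd_mx]. *)
Definition phomog a0 a1 b0 b1 (e : bool) (P : 'M[C]_(a0 + a1, b0 + b1)) :=
  gradmx a0 a1 *m P = (-1) ^+ e *: (P *m gradmx b0 b1).

Lemma gradmxK a0 a1 : gradmx a0 a1 *m gradmx a0 a1 = 1%:M.
Proof.
rewrite /gradmx mulmx_block !mulmx0 !mul0mx mulmx1 mulNmx mulmxN mulmx1 opprK.
by rewrite !addr0 add0r -scalar_mx_block.
Qed.

Lemma phomog_mul a0 a1 b0 b1 c0 c1 e f (P : 'M[C]_(a0 + a1, b0 + b1))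
    (Q : 'M[C]_(b0 + b1, c0 + c1)) :
  phomog e P -> phomog f Q -> phomog (e (+) f) (P *m Q).
Proof.
rewrite /phomog => hP hQ.
by rewrite mulmxA hP -scalemxAl -mulmxA hQ -scalemxAr scalerA mulmxA signr_addb.
Qed.

Lemma phomog_add a0 a1 b0 b1 e (P Q : 'M[C]_(a0 + a1, b0 + b1)) :
  phomog e P -> phomog e Q -> phomog e (P + Q).
Proof. by rewrite /phomog => hP hQ; rewrite mulmxDr hP hQ mulmxDl scalerDr. Qed.

Lemma phomog_scale a0 a1 b0 b1 e c (P : 'M[C]_(a0 + a1, b0 + b1)) :
  phomog e P -> phomog e (c *: P).
Proof.
by rewrite /phomog => hP; rewrite -scalemxAr hP -scalemxAl !scalerA mulrC.
Qed.

Lemma phomog_opp a0 a1 b0 b1 e (P : 'M[C]_(a0 + a1, b0 + b1)) :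
  phomog e P -> phomog e (- P).
Proof. by rewrite -scaleN1r; apply: phomog_scale. Qed.

Lemma phomog_sub a0 a1 b0 b1 e (P Q : 'M[C]_(a0 + a1, b0 + b1)) :
  phomog e P -> phomog e Q -> phomog e (P - Q).
Proof. by move=> hP hQ; apply: phomog_add => //; apply: phomog_opp. Qed.

Lemma phomog0 a0 a1 b0 b1 e : phomog e (0 : 'M[C]_(a0 + a1, b0 + b1)).
Proof. by rewrite /phomog mulmx0 mul0mx scaler0. Qed.

Lemma phomog_sum a0 a1 b0 b1 e (I : Type) (r : seq I) (S : pred I)
    (F : I -> 'M[C]_(a0 + a1, b0 + b1)) :
  (forall i, S i -> phomog e (F i)) -> phomog e (\sum_(i <- r | S i) F i).
Proof.
by move=> h; elim/big_rec: _ => [|i P Si hP]; [apply: phomog0 | apply/phomog_add/hP/h].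
Qed.

Lemma phomog_scalar a0 a1 (c : C) : phomog false (c%:M : 'M_(a0 + a1)).
Proof. by rewrite /phomog scale1r scalar_mxC. Qed.

Lemma phomog_gradmx a0 a1 : phomog false (gradmx a0 a1).
Proof. by rewrite /phomog scale1r. Qed.

Lemma phomog_inv a0 a1 b0 b1 e (P : 'M[C]_(a0 + a1, b0 + b1)) Q :
  phomog e P -> P *m Q = 1%:M -> Q *m P = 1%:M -> phomog e Q.
Proof.
rewrite /phomog => hP PQ QP.
have Pg : P *m gradmx b0 b1 = (-1) ^+ e *: (gradmx a0 a1 *m P).
  by rewrite hP scalerA -expr2 sqrr_sign scale1r.
rewrite -[gradmx b0 b1]mul1mx -QP -(mulmxA Q) Pg -scalemxAr -scalemxAl.
by rewrite -(mulmxA Q) -(mulmxA _ P) PQ mulmx1.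
Qed.

(** Grading matrices are diagonal with entries 1 and -1, so on either side they only rescale a
    matrix unit. *)
Lemma phomog_delta a0 a1 b0 b1 i j :
  exists e, phomog e (delta_mx i j : 'M[C]_(a0 + a1, b0 + b1)).
Proof.
have gE c0 c1 (k : 'I_(c0 + c1)) : exists e : bool, forall l, 
    (gradmx c0 c1 k l = (-1) ^+ e * (k == l)%:R) /\
    (gradmx c0 c1 l k = (-1) ^+ e * (l == k)%:R).
  exists (if split k is inr _ then true else false) => l.
  rewrite -(splitK k) -(splitK l) unsplitK.
  case: (split k) => k1; case: (split l) => l1 /=;
  rewrite /gradmx ?block_mxEul ?block_mxEur ?block_mxEdl ?block_mxEdr ?mxE;
  rewrite ?eq_lshift ?eq_rshift ?eq_lrshift ?eq_rlshift ?mulr0 ?mul1r ?mulN1r //.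
have [e he] := gE a0 a1 i; have [f hf] := gE b0 b1 j.
have gl : gradmx a0 a1 *m delta_mx i j =
    (-1) ^+ e *: (delta_mx i j : 'M_(_, b0 + b1)).
  apply/matrixP => k l; rewrite !mxE (bigD1 i) //= big1 ?addr0 => [|m mi].
    by have [_ ->] := he k; rewrite !mxE eqxx /= -mulrA -natrM mulnb.
  by rewrite [delta_mx _ _ _ _]mxE (negPf mi) mulr0.
have gr : delta_mx i j *m gradmx b0 b1 =
    (-1) ^+ f *: (delta_mx i j : 'M_(a0 + a1, _)).
  apply/matrixP => k l; rewrite !mxE (bigD1 j) //= big1 ?addr0 => [|m mj].
    have [-> _] := hf l; rewrite !mxE eqxx /= andbT mulrCA -natrM mulnb.
    by rewrite [l == j]eq_sym.
  by rewrite [delta_mx _ _ _ _]mxE (negPf mj) andbF mul0r.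
exists (e (+) f); rewrite /phomog gl gr scalerA signr_addb -mulrA.
by rewrite -signr_addb addbb mulr1.
Qed.

Hypothesis nz2 : (2 : C) != 0.

Lemma eqNmx m n (A : 'M[C]_(m, n)) : A = - A -> A = 0.
Proof.
move/eqP; rewrite -addr_eq0 -mulr2n -scaler_nat scaler_eq0 (negPf nz2) /=.
by move/eqP.
Qed.

Lemma even_mxP a0 a1 b0 b1 (P : 'M[C]_(a0 + a1, b0 + b1)) :
  even_mx P <-> phomog false P.
Proof.
rewrite /even_mx /phomog scale1r -{3 4}[P]submxK /gradmx !mulmx_block.
rewrite !(mul0mx, mulmx0, mul1mx, mulmx1, add0r, addr0, mulNmx, mulmxN).
split=> [[-> ->]|/eq_block_mx [_ h1 h2 _]]; first by rewrite !oppr0.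
by split; apply: eqNmx.
Qed.

Lemma odd_mxP a0 a1 b0 b1 (P : 'M[C]_(a0 + a1, b0 + b1)) :
  odd_mx P <-> phomog true P.
Proof.
rewrite /odd_mx /phomog expr1 scaleN1r -{3 4}[P]submxK /gradmx !mulmx_block.
rewrite !(mul0mx, mulmx0, mul1mx, mulmx1, add0r, addr0, mulNmx, mulmxN).
rewrite opp_block_mx !opprK.
split=> [[-> ->]|/eq_block_mx [h1 _ _ h2]]; first by rewrite !oppr0.
by split; apply: eqNmx => //; rewrite -h2.
Qed.

End Grading.

Section Clifford.
Variables (C : fieldType) (n : nat).
Implicit Types (u v : Uh C n) (M N : smod C n).

Local Notation X_ M i := (act M (xi C i)).

Lemma umulXX (a b : 'X_{1..n}) :
  umul 'X_[a] 'X_[b] = msign C a b *: 'X_[a + b] :> Uh C n.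
Proof. by rewrite /umul !msuppX !big_seq1 !mcoeffX !eqxx !mul1r. Qed.

Lemma msignU (i : 'I_n) (b : 'X_{1..n}) :
  msign C U_(i) b = (-1) ^+ (\sum_(j < n | (j < i)%N) b j)%N.
Proof.
rewrite /msign (bigD1 i) //= [X in (_ + X)%N]big1 => [|k /negPf ki].
  by rewrite addn0; under eq_bigr do rewrite mnm1E eqxx mul1n.
by rewrite big1 // => j _; rewrite mnm1E eq_sym ki.
Qed.

(** Only a left index above a right one contributes to [msign]: for i < j the product xi_i xi_j gets
    the sign 1 and xi_j xi_i the sign -1. *)
Lemma umul_xi_anticomm (i j : 'I_n) : i != j ->
  umul (xi C i) (xi C j) = - umul (xi C j) (xi C i).
Proof.
wlog lt_ij : i j / (i < j)%N => [hw ij|ij].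
  case: (ltngtP i j) => [h|h|/val_inj h]; first exact: hw.
    by rewrite [in RHS]hw ?opprK // eq_sym.
  by rewrite h eqxx in ij.
rewrite /xi !umulXX !msignU big1 => [|k ki].
  rewrite expr0 scale1r (bigD1 i) //= big1 => [|k /andP[_ /negPf ki]].
    by rewrite mnm1E eqxx addn0 expr1 scaleN1r opprK addmC.
  by rewrite mnm1E eq_sym ki.
by rewrite mnm1E; case: eqP => // jk; rewrite -jk ltnNge ltnW in ki.
Qed.

(** Up to sign, a nonconstant monomial is some xi_i times a monomial of smaller degree; induction on
    the degree reaches all monomials, linearity the rest. *)
Lemma Uh_ind (S : Uh C n -> Prop) :
  S 1 -> (forall i, S (xi C i)) -> (forall u v, S u -> S v -> S (u + v)) ->
  (forall c u, S u -> S (c *: u)) -> (forall u v, S u -> S v -> S (umul u v)) ->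
  forall u, S u.
Proof.
move=> S1 Sxi Sadd Sscale Smul u.
have SX m : S 'X_[m].
  have [d] := ubnP (mdeg m); elim: d m => // d IH m.
  have [->|m_neq0 le_md] := eqVneq m 0%MM; first by rewrite mpolyX0.
  have [i mi] : exists i, m i != 0%N.
    apply/existsP; apply: contra_neqT m_neq0; rewrite negb_exists => /forallP h.
    by apply/mnmP => i; rewrite mnm0E; apply/eqP; have := h i; rewrite negbK.
  have mE : m = (U_(i) + (m - U_(i)))%MM.
    apply/mnmP => j; rewrite mnmDE mnmBE mnm1E.
    by case: eqP => [<-|_]; rewrite ?subn0 // subnKC // lt0n.
  rewrite mE; have := umulXX U_(i) (m - U_(i)); rewrite msignU.
  set k := (\sum_(j < n | _) _)%N => h.
  have -> : 'X_[U_(i) + (m - U_(i))] = (-1) ^+ k *: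
      umul (xi C i) 'X_[m - U_(i)] :> Uh C n.
    by rewrite h scalerA -expr2 sqrr_sign scale1r.
  apply/Sscale/Smul => //; apply: IH.
  by move: le_md; rewrite [in X in X -> _]mE mdegD mdeg1.
rewrite [u]mpolyE; elim/big_ind: _ => //; last by move=> *; apply: Sscale.
by rewrite -(scale0r 1); apply: Sscale.
Qed.

Section Module.
Variable M : smod C n.
Hypothesis M_mod : Umod M.

Lemma act1 : act M 1 = 1%:M. Proof. by case: M_mod => -[]. Qed.
Lemma actD u v : act M (u + v) = act M u + act M v.
Proof. by case: M_mod => -[_ h _ _ _]; apply: h. Qed.
Lemma actZ c u : act M (c *: u) = c *: act M u.
Proof. by case: M_mod => -[_ _ h _ _]; apply: h. Qed.
Lemma actM u v : act M (umul u v) = act M v *m act M u.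
Proof. by case: M_mod => -[_ _ _ h _]; apply: h. Qed.
Lemma act0 : act M 0 = 0.
Proof. by rewrite -(scale0r 0) actZ scale0r. Qed.
Lemma actN u : act M (- u) = - act M u.
Proof. by rewrite -scaleN1r actZ scaleN1r. Qed.
Lemma act_sum (I : Type) (r : seq I) (P : pred I) F :
  act M (\sum_(i <- r | P i) F i) = \sum_(i <- r | P i) act M (F i).
Proof. exact: (big_morph _ actD act0). Qed.

Lemma act_xx i : act M (xx C i) = X_ M i *m X_ M i.
Proof. exact: actM. Qed.

Lemma act_xi_anticomm i j : i != j -> X_ M i *m X_ M j = - (X_ M j *m X_ M i).
Proof. by move=> ij; rewrite -!actM -actN -umul_xi_anticomm // eq_sym. Qed.

Hypothesis nz2 : (2 : C) != 0.

Lemma phomog_act_xi i : phomog true (X_ M i).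
Proof.
apply/odd_mxP => //; case: M_mod => _ [_]; apply=> //.
by rewrite /uoddp /xi msuppX /= mdeg1.
Qed.

End Module.

(** The reordering sign of ordered monomials, as in [msign]. By induction on m, the last power on
    the left crosses the earlier powers on the right, which costs the last a times the sum of the
    earlier b_j. *)
Lemma prod_anticomm_sign (R : pzRingType) m (Y : 'I_m -> R) (a b : 'I_m -> nat) :
  (forall i j, i != j -> Y i * Y j = - (Y j * Y i)) ->
  \prod_(i < m) Y i ^+ a i * \prod_(i < m) Y i ^+ b i =
  (-1) ^+ (\sum_(i < m) \sum_(j < m | (j < i)%N) (a i * b j))%N *
  \prod_(i < m) Y i ^+ (a i + b i).
Proof.
elim: m Y a b => [|m IH] Y a b Yac; first by rewrite !big_ord0 mul1r.
have signCA k (y z : R) : y * ((-1) ^+ k * z) = (-1) ^+ k * (y * z).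
  by rewrite mulrA (commr_sign y k) -mulrA.
have acX (y z : R) k : y * z = - (z * y) -> y ^+ k * z = (-1) ^+ k * (z * y ^+ k).
  move=> yz; elim: k => [|k IHk]; first by rewrite !mul1r mulr1.
  rewrite exprS -mulrA IHk [LHS]signCA [y * (z * _)]mulrA yz !mulNr mulrN.
  by rewrite [in RHS]exprS mulN1r !mulNr !mulrA.
have acXX (y z : R) k l : y * z = - (z * y) ->
    y ^+ k * z ^+ l = (-1) ^+ (k * l) * (z ^+ l * y ^+ k).
  move=> yz; elim: l => [|l IHl]; first by rewrite muln0 !mul1r mulr1.
  rewrite exprS [LHS]mulrA acX // -(mulrA (_ ^+ k)) -(mulrA z (y ^+ k)) IHl.
  rewrite (signCA _ z) -(mulrA z).
  by rewrite [LHS]mulrA -exprD mulnS.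
have ac_prod k (Z : R) r (y : 'I_r -> R) (c : 'I_r -> nat) :
   (forall i, Z * y i = - (y i * Z)) -> Z ^+ k * \prod_(i < r) y i ^+ c i =
   (-1) ^+ (\sum_(i < r) k * c i) * (\prod_(i < r) y i ^+ c i * Z ^+ k).
  elim: r y c => [|r IHr] y c h; first by rewrite !big_ord0 !mul1r mulr1.
  rewrite !big_ord_recr /= [LHS]mulrA IHr // -(mulrA (_ ^+ _))
    -(mulrA (\prod_(i < r) _)) acXX //.
  by rewrite (signCA _ (\prod_(i < r) _)) exprD -!mulrA.
have sumE : (\sum_(i < m.+1) \sum_(j < m.+1 | j < i) a i * b j =
    \sum_(i < m) \sum_(j < m | j < i) a (widen_ord (leqnSn m) i) *
      b (widen_ord (leqnSn m) j) +
    \sum_(j < m) a ord_max * b (widen_ord (leqnSn m) j))%N.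
  rewrite big_ord_recr /=; congr (_ + _)%N.
    apply: eq_bigr => i _; rewrite big_mkcond big_ord_recr /= -big_mkcond /=.
    by rewrite ltnNge (ltnW (ltn_ord i)) addn0.
  rewrite big_mkcond big_ord_recr /= -big_mkcond /= ltnn addn0.
  by apply: eq_bigl => i; rewrite ltn_ord.
rewrite sumE !big_ord_recr /= -mulrA (mulrA _ (\prod_(i < m) _)) ac_prod;
  last first.
  by move=> i; apply: Yac; rewrite -val_eqE /= gtn_eqF.
rewrite -(mulrA _ _ (_ ^+ b ord_max)) -(mulrA _ _ (_ ^+ b ord_max)).
rewrite signCA -exprD [X in _ * X = _](mulrA (\prod_(i < m) _)).
rewrite IH; last by move=> i j ij; apply: Yac.
by rewrite [in RHS]exprD -!mulrA signCA.
Qed.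

End Clifford.

(** * Modules from anticommuting families, and parity parts *)

Section CliffordRepresentations.
Variables (C : fieldType) (n : nat).
Implicit Types (u v : Uh C n) (M N : smod C n).

Local Notation X_ M i := (act M (xi C i)).

Section LinearExtension.
Variables (V : lmodType C) (F : 'X_{1..n} -> V).

Definition mlin u := \sum_(m <- msupp u) u@_m *: F m.

(** A range of monomials independent of the support, so that u, v and u + v can be compared term by
    term. *)
Lemma mlinwE k u : (msize u <= k)%N ->
  mlin u = \sum_(m : 'X_{1..n < k}) u@_m *: F m.
Proof.
move=> le_uk; rewrite /mlin (big_mksub 'X_{1..n < k}) ?msupp_uniq //=.
  rewrite big_rmcond //= => m /memN_msupp_eq0 ->; exact: scale0r.
by move=> m /msize_mdeg_lt h; exact: leq_trans h le_uk.
Qed.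

Lemma mlinD u v : mlin (u + v) = mlin u + mlin v.
Proof.
pose k := maxn (msize (u + v)) (maxn (msize u) (msize v)).
rewrite !(@mlinwE k) ?leq_max ?leqnn ?orbT // -big_split /=.
by apply: eq_bigr => m _; rewrite mcoeffD scalerDl.
Qed.

Lemma mlinZ c u : mlin (c *: u) = c *: mlin u.
Proof.
pose k := maxn (msize (c *: u)) (msize u).
rewrite !(@mlinwE k) ?leq_max ?leqnn ?orbT // scaler_sumr.
by apply: eq_bigr => m _; rewrite mcoeffZ scalerA.
Qed.

Lemma mlin0 : mlin 0 = 0.
Proof. by rewrite -(scale0r 0) mlinZ scale0r. Qed.

Lemma mlin_sum (I : Type) (r : seq I) (P : pred I) G :
  mlin (\sum_(i <- r | P i) G i) = \sum_(i <- r | P i) mlin (G i).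
Proof. exact: (big_morph _ mlinD mlin0). Qed.

Lemma mlinX m : mlin 'X_[m] = F m.
Proof. by rewrite /mlin msuppX big_seq1 mcoeffX eqxx scale1r. Qed.

End LinearExtension.

Section CliffordModule.
Variables (d0 d1 : nat) (X : 'I_n -> 'M[C]_(d0 + d1)).
Local Notation Mc := ('M[C]_(d0 + d1))^c%type.

(* In the converse ring, because the leftmost factor of xi^m acts last, that is,
   stands rightmost in the matrix product. *)
Definition cmon (m : 'X_{1..n}) : 'M[C]_(d0 + d1) :=
  \prod_(i < n) (X i : Mc) ^+ m i.

Definition cmod : smod C n := @SMod C n d0 d1 (mlin cmon).

Lemma cmod_xi i : X_ cmod i = X i.
Proof.
rewrite /= /xi mlinX /cmon -[RHS](big_pred1_eq (@GRing.mul Mc) i X) big_mkcond.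
by apply: eq_bigr => j _; rewrite mnm1E eq_sym; case: eqP.
Qed.

Hypothesis X_odd : forall i, phomog true (X i).
Hypothesis X_anticomm : forall i j, i != j -> X i *m X j = - (X j *m X i).
Hypothesis nz2 : (2 : C) != 0.

Lemma cmonM a b : cmon b *m cmon a = msign C a b *: cmon (a + b)%MM.
Proof.
have h := @prod_anticomm_sign Mc n X a b.
rewrite -[_ *m _]/((cmon a : Mc) * (cmon b : Mc)) h; last first.
  by move=> i j ij; apply: X_anticomm; rewrite eq_sym.
have -> : cmon (a + b)%MM = \prod_(i < n) (X i : Mc) ^+ (a i + b i).
  by apply: eq_bigr => i _; rewrite mnmDE.
rewrite /msign.
(* The two signs live in different rings, matrices and scalars, so both are reduced to the parity of
   the exponent. *)
set k := (\sum_(i < n) _)%N; set P := \prod_(i < n) _.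
rewrite -(signr_odd Mc k) -(signr_odd C k); case: (odd k);
  last by rewrite !expr0 scale1r mul1r.
by rewrite !expr1 scaleN1r mulN1r.
Qed.

Lemma phomog_cmon m : phomog (odd (mdeg m)) (cmon m).
Proof.
have hX i k : phomog (odd k) ((X i : Mc) ^+ k : 'M_(d0 + d1)).
  elim: k => [|k IH]; first exact: phomog_scalar.
  by rewrite exprSr -[odd _]/(~~ odd k) -addTb; apply: phomog_mul.
rewrite mdegE /cmon; elim/big_rec2: _ => [|i k P _ hP].
  exact: phomog_scalar.
by rewrite oddD addbC; apply: phomog_mul.
Qed.

Lemma cmod_Umod : Umod cmod.
Proof.
split; [split|split] => /=.
- rewrite -mpolyX0 mlinX /cmon big1 // => i _; by rewrite mnm0E expr0.
- by move=> u v _ _; apply: mlinD.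
- by move=> c u _; apply: mlinZ.
- move=> u v _ _; rewrite /umul mlin_sum.
  under eq_bigr => a _ do rewrite mlin_sum.
  rewrite {2}/mlin mulmx_sumr; apply: eq_bigr => a _.
  rewrite mulmx_suml; apply: eq_bigr => b _.
  rewrite mlinZ mlinX -scalemxAl -scalemxAr cmonM !scalerA.
  by congr (_ *: _); rewrite -mulrA mulrCA mulrA.
- move=> u _ /allP hu; apply/even_mxP => //; rewrite /mlin big_seq.
  apply: phomog_sum => m /hu mE; apply: phomog_scale.
  by have := phomog_cmon m; rewrite (negPf mE).
- move=> u _ /allP hu; apply/odd_mxP => //; rewrite /mlin big_seq.
  apply: phomog_sum => m /hu mE; apply: phomog_scale.
  by have := phomog_cmon m; rewrite mE.
Qed.

End CliffordModule.

Lemma mcoeff_upart e u m :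
  (upart e u)@_m = if odd (mdeg m) == e then u@_m else 0.
Proof.
rewrite /upart raddf_sum /=.
under eq_bigr do rewrite mcoeffZ mcoeffX.
have [mu|mu] := boolP (m \in msupp u); last first.
  rewrite big_seq_cond big1 => [|k /andP[ku _]].
    by rewrite (memN_msupp_eq0 mu) if_same.
  by case: eqP => [km|_]; rewrite ?mulr0 // -km ku in mu *.
rewrite big_mkcond (bigD1_seq m) ?msupp_uniq //= big1 => [|k /negPf km].
  by rewrite eqxx mulr1 addr0.
by rewrite km mulr0 if_same.
Qed.

Lemma upart_addE u : upart false u + upart true u = u.
Proof.
apply/mpolyP => m; rewrite mcoeffD !mcoeff_upart.
by case: (odd _); rewrite /= ?addr0 ?add0r.
Qed.

Lemma upart_even u : uevenp (upart false u).
Proof.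
apply/allP => m; rewrite mcoeff_msupp mcoeff_upart.
by case: (odd _) => //=; rewrite eqxx.
Qed.

Lemma upart_odd u : uoddp (upart true u).
Proof.
apply/allP => m; rewrite mcoeff_msupp mcoeff_upart.
by case: (odd _) => //=; rewrite eqxx.
Qed.

Section Module.
Variable M : smod C n.
Hypothesis M_mod : Umod M.
Hypothesis nz2 : (2 : C) != 0.

Lemma phomog_upart e u : phomog e (act M (upart e u)).
Proof.
case: M_mod => _ [he ho]; case: e.
  by apply/odd_mxP => //; apply: ho; rewrite ?upart_odd.
by apply/even_mxP => //; apply: he; rewrite ?upart_even.
Qed.

(** Conjugation by the grading matrix fixes even operators and negates odd ones. Properties stable
    under linear combinations and this conjugation thus pass from [ubig] to its parts [ugen]. *)
Lemma act_upart e u : act M (upart e u) =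
  2^-1 *: (act M u +
    (-1) ^+ e *: (gradmx C (d0 M) (d1 M) *m act M u *m gradmx C (d0 M) (d1 M))).
Proof.
have h := phomog_upart _ u; set G := gradmx C _ _.
have gE f : G *m act M (upart f u) *m G = (-1) ^+ f *: act M (upart f u).
  by rewrite h -scalemxAl -mulmxA gradmxK mulmx1.
rewrite -{2 3}(upart_addE u) actD // mulmxDr mulmxDl !gE expr0 scale1r.
have half (A : 'M[C]_(d0 M + d1 M)) : 2^-1 *: (A + A) = A.
  by rewrite -mulr2n -scaler_nat scalerA mulVf // scale1r.
case: e; rewrite ?expr0 ?expr1 ?scale1r scaleN1r.
  by rewrite scaleN1r opprD opprK addrACA subrr add0r half.
by rewrite addrACA subrr addr0 half.
Qed.

(** The sign of a factor depends only on the number of factors to its right, so prepending an index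
    leaves the other factors unchanged. *)
Lemma act_ufactor_uprod i (e : seq 'I_n) : act M (uprod C (i :: e)) =
  act M (uprod C e) *m (X_ M i *m X_ M i + (-1) ^+ size e *: X_ M i).
Proof.
have -> : uprod C (i :: e) = umul (xx C i + (-1) ^+ size e *: xi C i) (uprod C e).
  rewrite /uprod /= big_cons /= /ufactor /= subSS subn0; congr umul.
  have -> : zip e (iota 1 (size e)) =
      [seq (p.1, p.2.+1) | p <- zip e (iota 0 (size e))].
    by elim: e (size e) 0%N => [|j e IH] [|m] k //=; rewrite IH.
  by rewrite big_map; apply: eq_bigr => p _ /=; rewrite /ufactor subSS.
by rewrite actM // actD // actZ // act_xx.
Qed.

End Module.
End CliffordRepresentations.

(** * Restriction to W^n *)

Section RestrictionToW.
Variables (C : fieldType) (n : nat).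
Implicit Types (u v : Uh C n) (M N : smod C n).

Local Notation X_ M i := (act M (xi C i)).

Section ElementarySymmetric.
Variables (d : nat) (Y : nat -> 'I_n -> 'M[C]_d).

(** The order is reversed because a left action is written on row vectors; [Y k i] stands for the
    factor of index i with k factors to its right in U(h_n). *)
Fixpoint rprod (e : seq 'I_n) : 'M[C]_d :=
  if e is i :: e' then rprod e' *m Y (size e') i else 1%:M.

(** A noncommutative elementary symmetric sum, by the recursion that drops or uses the head of the
    list. *)
Fixpoint esym (l : seq 'I_n) (k : nat) : 'M[C]_d :=
  match l, k with
  | _, 0 => 1%:M
  | [::], _.+1 => 0
  | i :: l', k'.+1 => esym l' k + esym l' k' *m Y k' i
  end.

Lemma esym0 l : esym l 0 = 1%:M. Proof. by case: l. Qed.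

(** Subsets are split by whether they contain the head i; those that do are i |: J with J inside the
    tail. *)
Lemma sum_rprod l k : uniq l ->
  \sum_(I : {set 'I_n} | (I \subset [set x in l]) && (#|I| == k))
     rprod [seq x <- l | x \in I] = esym l k.
Proof.
elim: l k => [|i l IH] k /=.
  have -> : [set x in [::]] = set0 :> {set 'I_n} by apply/setP => x; rewrite !inE.
  under eq_bigl do rewrite subset0.
  case: k => [|k] _.
    rewrite (big_pred1 set0) // => I /=.
    by case: eqP => [->|] //; rewrite cards0.
  rewrite big1 // => I /andP[/eqP ->]; by rewrite cards0.
case/andP => il ul.
have il' : i \notin [set x in l] by rewrite inE.
have setE : [set x in i :: l] = i |: [set x in l].
  by apply/setP => x; rewrite !inE.
rewrite (bigID (fun I : {set 'I_n} => i \in I)) /= addrC.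
rewrite (eq_big (fun I : {set 'I_n} => (I \subset [set x in l]) && (#|I| == k))
    (fun I : {set 'I_n} => rprod [seq x <- l | x \in I])); first last.
- by move=> I /andP[_ /negPf ->].
- move=> I /=; rewrite setE; apply/andP/andP => [[/andP[sI ->] iI]|[sI ->]].
    split=> //; apply/subsetP => x xI; move/subsetP/(_ x xI): sI.
    by rewrite !inE; case: eqP => // xi; rewrite -xi xI in iI.
  split; last by apply: contra il' => iI; apply: (subsetP sI).
  by rewrite andbT; apply: subset_trans sI (subsetUr _ _).
rewrite IH //; case: k => [|k].
  rewrite big1 ?addr0 ?esym0 // => I /andP[/andP[_ /eqP/cards0_eq ->]].
  by rewrite inE.
congr (_ + _); rewrite -IH // mulmx_suml.
rewrite (reindex_onto (fun J : {set 'I_n} => i |: J) (fun I => I :\ i)); last first.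
  by move=> I /andP[_ iI]; rewrite setD1K.
have filt (J : {set 'I_n}) : [seq x <- l | x \in i |: J] = [seq x <- l | x \in J].
  apply: eq_in_filter => x xl; rewrite !inE; case: eqP => // xi.
  by rewrite -xi xl in il.
have sizeF (J : {set 'I_n}) : J \subset [set x in l] ->
    size [seq x <- l | x \in J] = #|J|.
  move=> sJ; rewrite -(card_uniqP (filter_uniq _ ul)); apply: eq_card => x.
  rewrite mem_filter; case: (boolP (x \in J)) => //= xJ.
  by move/subsetP/(_ x xJ): sJ; rewrite inE.
apply: eq_big => [J|J /andP[/andP[/andP[sJ cJ] _] /eqP eJ]].
  rewrite setU11 andbT /= setE; apply/andP/andP => [[/andP[sJ cJ] /eqP eJ]|[sJ cJ]].
    have iJ : i \notin J by rewrite -eJ !inE eqxx.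
    split; last by rewrite cardsU1 iJ add1n eqSS in cJ.
    apply/subsetP => x xJ; have := subsetP sJ x; rewrite !inE xJ orbT => /(_ isT).
    by case: eqP => // xi; rewrite -xi xJ in iJ.
  have iJ : i \notin J by apply: contra il' => iJ; apply: (subsetP sJ).
  by rewrite setUS // cardsU1 iJ add1n eqSS cJ setU1K.
have iJ : i \notin J by rewrite -eJ !inE eqxx.
rewrite setU11 /= filt sizeF; last first.
  apply/subsetP => x xJ; have := subsetP sJ x; rewrite setE !inE xJ orbT => /(_ isT).
  by case: eqP => // xi; rewrite -xi xJ in iJ.
by move: cJ; rewrite cardsU1 iJ add1n eqSS => /eqP ->.
Qed.

End ElementarySymmetric.

Section Action.
Variable M : smod C n.

Definition wfactor (k : nat) (i : 'I_n) : 'M[C]_(d0 M + d1 M) :=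
  X_ M i *m X_ M i + (-1) ^+ k *: X_ M i.

Hypothesis M_mod : Umod M.

Lemma act_ubig k : act M (ubig C n k) = esym wfactor (enum 'I_n) k.
Proof.
rewrite /ubig act_sum // -sum_rprod ?enum_uniq //; apply: eq_big => [I|I _].
  by rewrite (_ : [set x in _] = setT) ?subsetT // ; apply/setP => x;
     rewrite !inE mem_enum.
have -> : [seq x <- enum 'I_n | x \in I] = enum I.
  by rewrite enumT; apply: eq_filter.
elim: (enum I) => [|i e IH]; last by rewrite act_ufactor_uprod // IH.
by rewrite /uprod /= big_nil act1.
Qed.

End Action.

(* W^n only sees the pair (xi_i, xi_j) of adjacent indices through the
   subalgebra W^2, which is generated by the two combinations of R_sum and
   R_pair. *)
Lemma inW_rel (M N : smod C n)
    (R : 'M[C]_(d0 M + d1 M) -> 'M[C]_(d0 N + d1 N) -> Prop)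
    (l1 l2 : seq 'I_n) (i j : 'I_n) :
  (2 : C) != 0 -> Umod M -> Umod N ->
  R 1%:M 1%:M ->
  (forall A A' B B', R A A' -> R B B' -> R (A + B) (A' + B')) ->
  (forall c A A', R A A' -> R (c *: A) (c *: A')) ->
  (forall A A' B B', R A A' -> R B B' -> R (A *m B) (A' *m B')) ->
  (forall A A', R A A' ->
     R (gradmx C _ _ *m A *m gradmx C _ _) (gradmx C _ _ *m A' *m gradmx C _ _)) ->
  enum 'I_n = l1 ++ [:: i, j & l2] ->
  (forall k, k != i -> k != j -> R (X_ M k) (X_ N k)) ->
  (forall k, R (wfactor M k i + wfactor M k j) (wfactor N k i + wfactor N k j)) ->
  (forall k, R (wfactor M k j *m wfactor M k.+1 i)
               (wfactor N k j *m wfactor N k.+1 i)) ->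
  forall u, inW u -> R (act M u) (act N u).
Proof.
move=> nz2 MU NU R1 RD RZ RM RG enumE R_xi R_sum R_pair.
have R0 : R 0 0 by have := RZ 0 _ _ R1; rewrite !scale0r.
(* Indices outside the pair contribute related factors, so they may be put in front of related
   sums. *)
have R_list l0 l : i \notin l -> j \notin l ->
    (forall k, R (esym (wfactor M) l0 k) (esym (wfactor N) l0 k)) ->
    forall k, R (esym (wfactor M) (l ++ l0) k) (esym (wfactor N) (l ++ l0) k).
  elim: l => [|m l IH] //; rewrite !inE !negb_or => /andP[mi il] /andP[mj jl] h k.
  case: k => [|k] //=; apply/RD; first exact: IH.
  apply/RM; first exact: IH.
  have Rm : R (X_ M m) (X_ N m) by apply: R_xi; rewrite eq_sym.
  by apply/RD; [apply/RM | apply/RZ].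
have : uniq (enum 'I_n) by apply: enum_uniq.
rewrite enumE cat_uniq /= !inE !negb_or => /and5P[_ /and3P[il1 jl1 _] /andP[_ il2] jl2 _].
have R_ubig k : R (act M (ubig C n k)) (act N (ubig C n k)).
  rewrite !act_ubig // enumE; apply/R_list => // {}k.
  have R2 k' : R (esym (wfactor M) l2 k') (esym (wfactor N) l2 k').
    rewrite -(cats0 l2); apply/R_list => // -[|m] //.
  (* Here w and y are the factors of i and j with the same sign, z the factor of j with the opposite
     sign: the pair enters only through w + y and z w. *)
  have expandE d (a b c y z w : 'M[C]_d) : a + b *m y + (b + c *m z) *m w =
      a + b *m (w + y) + c *m (z *m w).
    by rewrite mulmxDl mulmxDr mulmxA -!addrA; congr (_ + _); rewrite addrCA.
  case: k => [|[|k]] //=.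
    have sumE d (a y z : 'M[C]_d) : a + y + z = a + (z + y).
      by rewrite -addrA (addrC y).
    rewrite !esym0 !mul1mx (sumE _ (esym _ _ _)) (sumE _ (esym (wfactor N) _ _)).
    by apply/RD; [exact: R2|exact: R_sum].
  by rewrite !expandE; apply/RD; [apply/RD => //|]; apply/RM.
move=> u; elim=> {u}.
- move=> k e _; rewrite /ugen !act_upart //.
  apply/RZ; apply/RD => //; apply/RZ; exact/RG.
- by rewrite !act1.
- by move=> u v _ Ru _ Rv; rewrite !actD //; apply/RD.
- by move=> c u _ Ru; rewrite !actZ //; apply/RZ.
- by move=> u v _ Ru _ Rv; rewrite !actM //; apply/RM.
Qed.

End RestrictionToW.

(** * Uniqueness of V(s) up to parity *)

Section Uniqueness.
Variables (C : fieldType) (n : nat).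
Hypothesis nz2 : (2 : C) != 0.
Implicit Types (u v : Uh C n) (M N : smod C n) (s : 'I_n -> C).

Local Notation X_ M i := (act M (xi C i)).
Local Notation Utrue := (fun _ : Uh C n => True).

Lemma block_diag_sub a0 a1 b0 b1 c0 c1 (A0 : 'M[C]_(a0, c0)) (A1 : 'M[C]_(a1, c1))
    (B0 : 'M[C]_(b0, c0)) (B1 : 'M[C]_(b1, c1)) :
  (A0 <= B0)%MS -> (A1 <= B1)%MS ->
  (block_mx A0 0 0 A1 <= block_mx B0 0 0 B1)%MS.
Proof.
move=> /submxP[D0 ->] /submxP[D1 ->]; apply/submxP; exists (block_mx D0 0 0 D1).
by rewrite mulmx_block !mulmx0 !mul0mx !addr0 !add0r.
Qed.

Lemma even_block_diag a0 a1 b0 b1 (P : 'M[C]_(a0 + a1, b0 + b1)) :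
  phomog false P -> P = block_mx (ulsubmx P) 0 0 (drsubmx P).
Proof. by move/(even_mxP nz2) => [h1 h2]; rewrite -{1}[P]submxK h1 h2. Qed.

Lemma stable_act M m (B : 'M[C]_(m, d0 M + d1 M)) : Umod M ->
  (forall i, B *m X_ M i <= B)%MS -> forall u, (B *m act M u <= B)%MS.
Proof.
move=> MU hB; apply: Uh_ind => //.
- by rewrite act1 // mulmx1.
- by move=> u v hu hv; rewrite actD // mulmxDr addmx_sub.
- by move=> c u hu; rewrite actZ // -scalemxAr scalemx_sub.
- by move=> u v hu hv; rewrite actM // mulmxA (submx_trans (submxMr _ hv)).
Qed.

(** The kernel of an even matrix is the sum of the kernels of its diagonal blocks, hence graded, and
    simplicity leaves 0 or everything. Asking only for a stable kernel also covers an X_i followed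
    by a parity swap. *)
Lemma kernel_simple M b0 b1 (P : 'M[C]_(d0 M + d1 M, b0 + b1)) :
  Umod M -> Usimple M -> phomog false P ->
  (forall m (A : 'M_(m, _)) i, A *m P = 0 -> A *m X_ M i *m P = 0) ->
  P = 0 \/ row_free P.
Proof.
move=> MU [_ MS] Pe stab.
pose K := block_mx (kermx (ulsubmx P)) 0 0 (kermx (drsubmx P)).
have PE := even_block_diag Pe.
have KP : K *m P = 0.
  rewrite [P]PE /K mulmx_block !mulmx0 !mul0mx !mulmx_ker !addr0.
  exact: block_mx0.
have subK m (A : 'M_(m, _)) : A *m P = 0 -> (A <= K)%MS.
  rewrite -{1}[A]hsubmxK {1}[P]PE mul_row_block !mulmx0 addr0 add0r.
  rewrite -(row_mx0 _ _ _ _) => /eq_row_mx[/eqP h0 /eqP h1].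
  move: h0 h1; rewrite -!sub_kermx => /submxP[D0 h0] /submxP[D1 h1].
  apply/submxP; exists (row_mx D0 D1).
  by rewrite mul_row_block !mulmx0 addr0 add0r -h0 -h1 hsubmxK.
have [|K0|K1] := MS (kermx (ulsubmx P)) (kermx (drsubmx P)).
- by apply: stable_act => // i; apply: subK; apply: stab.
- right; move/eqP: K0; rewrite -/K mxrank_eq0 -kermx_eq0 => /eqP K0.
  by have := subK _ (kermx P) (mulmx_ker P); rewrite K0 submx0.
- left; have : (1%:M <= K)%MS by rewrite sub1mx.
  by move/submxP => [D DK]; rewrite -[P]mul1mx DK -mulmxA KP mulmx0.
Qed.

Lemma schur M N (P : 'M[C]_(d0 M + d1 M, d0 N + d1 N)) :
  Umod M -> Umod N -> Usimple M -> Usimple N -> phomog false P -> P != 0 ->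
  (forall i, X_ M i *m P = P *m X_ N i) -> siso Utrue M N.
Proof.
move=> MU NU MS NS Pe P_neq0 PX.
have Pfree : row_free P.
  have [|P0|//] := kernel_simple MU MS Pe; last by rewrite P0 eqxx in P_neq0.
  by move=> m A i AP; rewrite -mulmxA PX mulmxA AP mul0mx.
have Pfull : row_full P.
  (* For an even P the row space is the sum of those of the two diagonal blocks, hence a graded
     submodule of N. *)
  pose B := block_mx <<ulsubmx P>>%MS 0 0 <<drsubmx P>>%MS.
  have BP : (B :=: P)%MS.
    apply/eqmxP; rewrite {1 2}(even_block_diag Pe).
    by rewrite !block_diag_sub ?genmxE.
  case: NS => _ /(_ <<ulsubmx P>>%MS <<drsubmx P>>%MS); rewrite -/B.
  case=> [u||].
  - rewrite (eqmxMr _ BP) BP; apply: stable_act u => // i.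
    by rewrite -PX submxMl.
  - by rewrite BP => /eqP; rewrite mxrank_eq0 (negPf P_neq0).
  - by rewrite /row_full BP.
exists P, (pinvmx P); split; last by apply: mulVpmx.
  split; first by apply/even_mxP.
  move=> u _; elim/Uh_ind: u => //.
  - by rewrite !act1 // mul1mx mulmx1.
  - by move=> u v hu hv; rewrite !actD // mulmxDl mulmxDr hu hv.
  - by move=> c u hu; rewrite !actZ // -scalemxAl -scalemxAr hu.
  - by move=> u v hu hv; rewrite !actM // -mulmxA hu mulmxA hv mulmxA.
exact: mulmxVp.
Qed.

(** The identity map seen as an odd isomorphism onto the parity shift; composing with it turns odd
    matrices into even ones. *)
Definition swapmx a0 a1 : 'M[C]_(a0 + a1, a1 + a0) := block_mx 0 1%:M 1%:M 0.

Lemma swapmxK a0 a1 : swapmx a0 a1 *m swapmx a1 a0 = 1%:M.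
Proof.
rewrite mulmx_block !mulmx0 !mul0mx !mulmx1 !addr0 add0r.
by rewrite -scalar_mx_block.
Qed.

Lemma phomog_swapmx a0 a1 : phomog true (swapmx a0 a1).
Proof. by apply/(odd_mxP nz2); rewrite /odd_mx block_mxKul block_mxKdr. Qed.

Lemma act_Pi M u :
  act (Pi M) u = swapmx (d1 M) (d0 M) *m act M u *m swapmx (d0 M) (d1 M).
Proof.
rewrite /= -{5}[act M u]submxK /swapmx !mulmx_block.
by rewrite !(mulmx0, mul0mx, mulmx1, mul1mx, addr0, add0r).
Qed.

Lemma is_V_Pi s M : is_V s M -> is_V s (Pi M).
Proof.
case=> MU [Md MS] Ms; pose T := swapmx (d1 M) (d0 M); pose T' := swapmx (d0 M) (d1 M).
have TT : T *m T' = 1%:M by apply: swapmxK.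
have TT' : T' *m T = 1%:M by apply: swapmxK.
have hT e (A : 'M_(d0 M + d1 M)) : phomog e A -> phomog e (T *m A *m T').
  move=> hA; have <- : (true (+) e) (+) true = e by case: (e).
  by do 2?apply: phomog_mul => //; apply: phomog_swapmx.
have [[a1 aD aZ aM] [ae ao]] := MU.
split; first split; first split.
- by rewrite act_Pi a1 mulmx1.
- by move=> u v _ _; rewrite !act_Pi aD // mulmxDr mulmxDl.
- by move=> c u _; rewrite !act_Pi aZ // -scalemxAr -scalemxAl.
- move=> u v _ _; rewrite !act_Pi aM // !mulmxA -[X in _ = X *m _ *m _]mulmxA.
  by rewrite TT' mulmx1.
- split=> u _ hu.
    by apply/even_mxP => //; rewrite act_Pi; apply/hT/even_mxP/ae.
  by apply/odd_mxP => //; rewrite act_Pi; apply/hT/odd_mxP/ao.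
- split; first by rewrite /= addnC.
  move=> S0 S1; set B := block_mx _ _ _ _ => hB.
  (* Exchanging the components carries graded submodules of [Pi M] to graded submodules of M and
     keeps the rank. *)
  have BE : block_mx S1 0 0 S0 = T' *m B *m T.
    rewrite /B /T /T' /swapmx !mulmx_block.
    by rewrite !(mulmx0, mul0mx, mulmx1, mul1mx, addr0, add0r).
  have Tfree : row_free T by apply/row_freeP; exists T'.
  have Tfull : row_full T' by apply/row_fullP; exists T.
  have BErank : \rank (block_mx S1 0 0 S0) = \rank B.
    by rewrite BE mxrankMfree // (eqmxMfull _ Tfull).
  have [u|h|h] := MS S1 S0; [|by left; rewrite -BErank|].
    rewrite BE -[T' *m B *m T]mulmxA (eqmxMfull _ Tfull).
    rewrite -(mulmxA T') -(mulmxA B) (eqmxMfull _ Tfull).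
    have := hB u; rewrite act_Pi -/T -/T' => /(submxMr T).
    by rewrite -!mulmxA TT' mulmx1.
  by right; move: h; rewrite /row_full BErank => /eqP ->; rewrite /= addnC.
- by move=> i; rewrite act_Pi Ms mul_mx_scalar -scalemxAl TT scalemx1.
Qed.

Lemma act_xi_sqr s M i : is_V s M -> X_ M i *m X_ M i = (s i)%:M.
Proof. by case=> MU _ <-; rewrite act_xx. Qed.

(** The kernel of X_i is a graded submodule, so X_i is zero or injective; as X_i squares to zero, it
    is 0 in both cases. *)
Lemma act_xi_eq0 s M i : is_V s M -> s i = 0 -> X_ M i = 0.
Proof.
move=> MV si; have [MU MS _] := MV.
have XX : X_ M i *m X_ M i = 0 by rewrite (act_xi_sqr _ MV) si raddf0.
pose P := X_ M i *m swapmx (d0 M) (d1 M).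
have PK m (A : 'M_(m, _)) : (A *m P = 0) <-> (A *m X_ M i = 0).
  split=> [/(congr1 (mulmx^~ (swapmx (d1 M) (d0 M))))|h].
    by rewrite mul0mx -!mulmxA swapmxK mulmx1.
  by rewrite mulmxA h mul0mx.
have Pe : phomog false P.
  by apply: (@phomog_mul _ _ _ _ _ _ _ true true);
    [apply: phomog_act_xi | apply: phomog_swapmx].
have [m A j /PK AP|P0|/row_freeP[Q PQ]] := kernel_simple MU MS Pe.
- apply/PK; have [->|ji] := eqVneq j i; first by rewrite -mulmxA XX mulmx0.
  by rewrite -mulmxA act_xi_anticomm // mulmxN mulmxA AP mul0mx oppr0.
- by rewrite -[X_ M i]mul1mx; apply/PK; rewrite P0 mulmx0.
- by rewrite -[X_ M i]mulmx1 -PQ mulmxA; move/PK: XX => ->; rewrite mul0mx.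
Qed.

Section Intertwiner.
Variables (s : 'I_n -> C) (M N : smod C n).
Hypotheses (MV : is_V s M) (NV : is_V s N).

Let NU : Umod N. Proof. by case: NV. Qed.
Let MU : Umod M. Proof. by case: MV. Qed.

Let G := gradmx C (d0 N) (d1 N).

Let GX i : G *m X_ N i = - (X_ N i *m G).
Proof. by rewrite (phomog_act_xi NU nz2) expr1 scaleN1r. Qed.

(* omega_l = G X_(i1) G ... X_(ir) G: each factor (X_i G) commutes with all
   X_k, k != i, and anticommutes with X_i. *)
Lemma exists_partial_volume l : uniq l -> {in l, forall i, s i != 0} ->
  exists (e : bool) (W W' : 'M[C]_(d0 N + d1 N)),
  [/\ phomog e W, W *m W' = 1%:M,
      {in l, forall i, X_ N i *m W = W *m X_ N i} &
      forall i, i \notin l -> X_ N i *m W = - (W *m X_ N i)].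
Proof.
elim: l => [|i l IH] /=.
  move=> _ _; exists false, G, G; split=> //.
  - exact: phomog_gradmx.
  - exact: gradmxK.
  - by move=> i _; rewrite GX opprK.
case/andP => il ul sl.
have [|e [W [W' [We WW' Wc Wa]]]] := IH ul.
  by move=> k kl; apply: sl; rewrite inE kl orbT.
have si : s i != 0 by apply: sl; rewrite inE eqxx.
have XG k : k != i -> X_ N k *m (X_ N i *m G) = (X_ N i *m G) *m X_ N k.
  move=> ki; rewrite mulmxA act_xi_anticomm // mulNmx -!mulmxA GX.
  by rewrite mulmxN.
have XiG : X_ N i *m (X_ N i *m G) = - ((X_ N i *m G) *m X_ N i).
  by rewrite -(mulmxA _ G) GX mulmxN opprK.
(* The new factor X_i G has the right inverse G X_i / s_i, since X_i^2 = s_i. *)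
exists (e (+) true), (W *m (X_ N i *m G)), (G *m ((s i)^-1 *: X_ N i) *m W').
split.
- apply: phomog_mul => //; apply: (@phomog_mul _ _ _ _ _ _ _ true false).
    exact: phomog_act_xi.
  exact: phomog_gradmx.
- rewrite -!mulmxA (mulmxA G) gradmxK mul1mx (mulmxA (X_ N i)) -scalemxAr.
  by rewrite (act_xi_sqr _ NV) scale_scalar_mx mulVf // mul1mx.
- move=> k; rewrite inE; case: (eqVneq k i) => [-> _|ki /= kl].
    by rewrite [LHS]mulmxA Wa // mulNmx -[in LHS](mulmxA W) XiG mulmxN opprK [LHS]mulmxA.
  by rewrite [LHS]mulmxA Wc // -[in LHS](mulmxA W) XG // !mulmxA.
- move=> k; rewrite inE negb_or => /andP[ki kl].
  by rewrite [LHS]mulmxA Wa // mulNmx -[in LHS](mulmxA W) XG // !mulmxA.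
Qed.

Lemma exists_partial_intertwiner l : uniq l -> {in l, forall i, s i != 0} ->
  exists (e : bool) (P : 'M[C]_(d0 M + d1 M, d0 N + d1 N)),
  [/\ phomog e P, P != 0 & {in l, forall i, X_ M i *m P = P *m X_ N i}].
Proof.
elim: l => [|i l IH] /=.
  move=> _ _; case: MV => _ [dM _] _; case: NV => _ [dN _] _.
  have [e he] := @phomog_delta C _ _ _ _ (Ordinal dM) (Ordinal dN).
  exists e, (delta_mx (Ordinal dM) (Ordinal dN)); split=> //.
  apply/eqP => /matrixP/(_ (Ordinal dM) (Ordinal dN)); rewrite !mxE !eqxx.
  by move/eqP; rewrite oner_eq0.
case/andP => il ul sl.
have sl' : {in l, forall k, s k != 0} by move=> k kl; apply: sl; rewrite inE kl orbT.
have si : s i != 0 by apply: sl; rewrite inE eqxx.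
have [e [P [Pe P0 Pc]]] := IH ul sl'.
have XM := act_xi_sqr i MV; have XN := act_xi_sqr i NV.
(* The average over X_i: it intertwines X_i because X_i^2 = s_i on both modules, and still
   intertwines X_k for k in l because two signs cancel. *)
have [T0|T_neq0] := eqVneq (s i *: P + X_ M i *m P *m X_ N i) 0; last first.
  exists e, (s i *: P + X_ M i *m P *m X_ N i); split=> //.
    apply: phomog_add; first exact: phomog_scale.
    have <- : (true (+) e) (+) true = e by case: (e).
    by do 2?apply: phomog_mul => //; apply: phomog_act_xi.
  move=> k; rewrite inE mulmxDr mulmxDl -scalemxAr -scalemxAl.
  case: (eqVneq k i) => [-> _|ki /= kl].
    rewrite !mulmxA XM -(mulmxA (_ *m P)) XN mul_scalar_mx mul_mx_scalar.
    by rewrite addrC -scalemxAl.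
  rewrite !mulmxA (Pc k kl); congr (_ + _).
  rewrite (act_xi_anticomm MU ki) !mulNmx -(mulmxA _ (X_ M k) P) (Pc k kl).
  by rewrite -!mulmxA (act_xi_anticomm NU ki) !mulmxN opprK.
(* A vanishing average, multiplied by X_i and divided by s_i, gives the sign -1. The volume element
   of l repairs it: it anticommutes with X_i, as i is not in l, and commutes with X_k for k in l. *)
have XPa : X_ M i *m P = - (P *m X_ N i).
  move/(congr1 (mulmx^~ (X_ N i))): T0.
  rewrite mulmxDl mul0mx -(mulmxA (_ *m P)) XN mul_mx_scalar -scalemxAl -scalerDr.
  by move/eqP; rewrite scaler_eq0 (negPf si) /= addrC addr_eq0 => /eqP.
have [f [W [W' [Wf WW' Wc Wa]]]] := exists_partial_volume ul sl'.
exists (e (+) f), (P *m W); split.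
- exact: phomog_mul.
- apply: contra_neq P0 => PW; by rewrite -[P]mulmx1 -WW' mulmxA PW mul0mx.
- move=> k; rewrite inE; case: (eqVneq k i) => [-> _|ki /= kl].
    by rewrite [LHS]mulmxA XPa mulNmx -!(mulmxA P) Wa // mulmxN opprK.
  by rewrite [LHS]mulmxA Pc // -!(mulmxA P) Wc.
Qed.

Lemma is_V_unique : siso Utrue M N \/ siso Utrue M (Pi N).
Proof.
(* Only indices with s_i nonzero are averaged over; at the others X_i is 0 on both modules. *)
have [|i|e [P [Pe P0 Pc]]] :=
  @exists_partial_intertwiner [seq i <- enum 'I_n | s i != 0].
- by rewrite filter_uniq ?enum_uniq.
- by rewrite mem_filter => /andP[].
have PX i : X_ M i *m P = P *m X_ N i.
  have [si|si] := eqVneq (s i) 0; last by apply: Pc; rewrite mem_filter si mem_enum.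
  by rewrite (act_xi_eq0 MV si) (act_xi_eq0 NV si) mul0mx mulmx0.
have [_ MS _] := MV; have [_ NS _] := NV.
case: e Pe => Pe; last by left; apply: schur Pe P0 PX.
have [PU PS _] := is_V_Pi NV.
(* An odd intertwiner becomes even when followed by the swap onto [Pi N]. *)
right; apply: (@schur _ (Pi N) (P *m swapmx (d0 N) (d1 N))) => //.
- by apply: (@phomog_mul _ _ _ _ _ _ _ true true) => //; apply: phomog_swapmx.
- apply: contra_neq P0 => PW.
  by rewrite -[P]mulmx1 -(swapmxK (d0 N) (d1 N)) mulmxA PW mul0mx.
- move=> i; rewrite act_Pi !mulmxA PX; congr (_ *m _).
  by rewrite -!mulmxA (mulmxA (swapmx _ _)) swapmxK mul1mx.
Qed.

End Intertwiner.

End Uniqueness.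

(** * The Grothendieck group of W^n-modules *)

Section Grothendieck.
Variables (C : fieldType) (n : nat).
Hypothesis nz2 : (2 : C) != 0.
Implicit Types (u v : Uh C n) (M N : smod C n).

Lemma Umod_Wmod M : Umod M -> Wmod M.
Proof.
by case=> -[h1 hD hZ hM] [he ho]; split; [split=> // *; [exact: hD|exact: hZ|exact: hM]|];
  split=> u _; [exact: he|exact: ho].
Qed.

Lemma siso_sub (A B : Uh C n -> Prop) M N :
  (forall u, A u -> B u) -> siso B M N -> siso A M N.
Proof.
move=> AB [P [Q [[Pe PB] PQ QP]]]; exists P, Q; split=> //; split=> // u /AB.
exact: PB.
Qed.

Lemma siso_eq_act (A : Uh C n -> Prop) M (g : Uh C n -> 'M[C]_(d0 M + d1 M)) :
  (forall u, A u -> act M u = g u) -> siso A M (SMod g).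
Proof.
move=> fg; exists 1%:M, 1%:M; rewrite mulmx1; split=> //; split.
  by apply/even_mxP => //; apply: phomog_scalar.
by move=> u /fg /= ->; rewrite mulmx1 mul1mx.
Qed.

Lemma siso_sym (A : Uh C n -> Prop) M N : siso A M N -> siso A N M.
Proof.
move=> [P [Q [[Pe PA] PQ QP]]]; exists Q, P; split=> //; split.
  by apply/even_mxP => //; apply: phomog_inv QP => //; apply/even_mxP.
move=> u /PA Pu; rewrite -[LHS]mul1mx -QP -!mulmxA (mulmxA P) -Pu -mulmxA PQ.
by rewrite mulmx1.
Qed.

Lemma siso_trans (A : Uh C n -> Prop) M N L :
  siso A M N -> siso A N L -> siso A M L.
Proof.
move=> [P [Q [[Pe PA] PQ QP]]] [P' [Q' [[Pe' PA'] PQ' QP']]].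
exists (P *m P'), (Q' *m Q); split.
- split; last by move=> u Au; rewrite mulmxA PA // -!mulmxA PA'.
  apply/even_mxP => //; apply: (@phomog_mul _ _ _ _ _ _ _ false false);
  exact/even_mxP.
- by rewrite -mulmxA (mulmxA P') PQ' mul1mx.
- by rewrite -mulmxA (mulmxA Q) QP mul1mx.
Qed.

Lemma indW_siso M N X : siso (@inW C n) M N -> indW X M = indW X N.
Proof.
move=> MN; rewrite /indW.
case: excluded_middle_informative => h1;
  case: excluded_middle_informative => h2 //; exfalso.
  by apply: h2; apply: siso_trans h1; apply: siso_sym.
by apply: h1; apply: siso_trans h2.
Qed.

Lemma K0eq_siso M N : siso (@inW C n) M N -> K0eq M N.
Proof.
move=> MN; exists 0%N, (fun _ => 0), (fun _ => M), (fun _ => M), (fun _ => M).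
split; first by case.
by move=> X _; rewrite big_ord0 (indW_siso _ MN) subrr.
Qed.

Lemma K0eq_trans M N L : K0eq M N -> K0eq N L -> K0eq M L.
Proof.
move=> [k1 [c1 [A1 [E1 [B1 [h1 e1]]]]]] [k2 [c2 [A2 [E2 [B2 [h2 e2]]]]]].
pose glue T (f : 'I_k1 -> T) (g : 'I_k2 -> T) (t : 'I_(k1 + k2)) :=
  match split t with inl x => f x | inr y => g y end.
have gl T f g x : @glue T f g (lshift k2 x) = f x by rewrite /glue (unsplitK (inl _ x)).
have gr T f g x : @glue T f g (rshift k1 x) = g x by rewrite /glue (unsplitK (inr _ x)).
exists (k1 + k2)%N, (glue _ c1 c2), (glue _ A1 A2), (glue _ E1 E2), (glue _ B1 B2).
split; first by move=> t; rewrite /glue; case: split.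
move=> X XW; rewrite big_split_ord /=.
under eq_bigr do rewrite !gl; under [Z in _ = _ + Z]eq_bigr do rewrite !gr.
by rewrite -e1 // -e2 // addrA subrK.
Qed.

(** The diagonal block of the action on a graded summand with inclusion R and projection L. *)
Definition compress M k0 k1 (R : 'M[C]_(k0 + k1, d0 M + d1 M))
    (L : 'M[C]_(d0 M + d1 M, k0 + k1)) : smod C n :=
  SMod (fun u => R *m act M u *m L).

(* M splits as a graded space into the images of R1 and R2, with projections
   L1 and L2, and the image of R1 is a submodule *)
Lemma Wses_compress M k0 k1 l0 l1 (R1 : 'M[C]_(k0 + k1, d0 M + d1 M))
    (L1 : 'M[C]_(d0 M + d1 M, k0 + k1)) (R2 : 'M[C]_(l0 + l1, d0 M + d1 M))
    (L2 : 'M[C]_(d0 M + d1 M, l0 + l1)) :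
  Wmod M -> phomog false R1 -> phomog false L1 -> phomog false R2 ->
  phomog false L2 -> L1 *m R1 + L2 *m R2 = 1%:M -> R1 *m L1 = 1%:M ->
  R2 *m L2 = 1%:M -> (forall u, inW u -> R1 *m act M u *m L2 = 0) ->
  Wses (compress R1 L1) M (compress R2 L2).
Proof.
move=> MW R1e L1e R2e L2e id12 id1 id2 stab.
have [[a1 aD aZ aM] [ae ao]] := MW.
have homg e j0 j1 (R : 'M[C]_(j0 + j1, d0 M + d1 M)) L A :
    phomog false R -> phomog false L -> phomog e A -> phomog e (R *m A *m L).
  move=> hR hL hA; have <- : (false (+) e) (+) false = e by case: (e).
  by do 2?apply: phomog_mul.
(* The identity is inserted between two operators; when R1 u L2 = 0 one term disappears, which makes
   both diagonal blocks multiplicative. *)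
have ins m m' (A : 'M_(m, _)) (B : 'M_(_, m')) :
    A *m B = A *m L1 *m (R1 *m B) + A *m L2 *m (R2 *m B).
  by rewrite -{1}[A]mulmx1 -id12 mulmxDr mulmxDl !mulmxA.
have R1L2 : R1 *m L2 = 0.
  by have := stab 1 (inW_one _ _); rewrite a1 mulmx1.
have wm j0 j1 (R : 'M[C]_(j0 + j1, d0 M + d1 M)) L : phomog false R ->
    phomog false L -> R *m L = 1%:M ->
    (forall u v, inW u -> inW v -> R *m act M v *m act M u *m L =
       R *m act M v *m L *m (R *m act M u *m L)) -> Wmod (compress R L).
  move=> hR hL id hM; split; [split|split] => /=.
  - by rewrite a1 mulmx1.
  - by move=> u v hu hv; rewrite aD // mulmxDr mulmxDl.
  - by move=> c u hu; rewrite aZ // -scalemxAr -scalemxAl.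
  - by move=> u v hu hv; rewrite aM // mulmxA hM.
  - by move=> u hu ue; apply/even_mxP => //; apply: homg => //; apply/even_mxP/ae.
  - by move=> u hu ue; apply/odd_mxP => //; apply: homg => //; apply/odd_mxP/ao.
split=> //.
- apply: wm => // u v hu hv; rewrite -mulmxA ins stab // mul0mx addr0.
  by rewrite (mulmxA R1).
- apply: wm => // u v hu hv; rewrite -mulmxA ins (mulmxA R1) stab // mulmx0 add0r.
  by rewrite (mulmxA R2).
(* On row vectors R1 is the inclusion of the submodule and L2 the projection onto the quotient. *)
exists R1, L2; split.
- split; first exact/even_mxP.
  move=> u hu /=; rewrite -[in RHS](mulmx1 (R1 *m _)) -id12 mulmxDr.
  by rewrite (mulmxA _ L2) stab // mul0mx addr0 mulmxA.
- split; first exact/even_mxP.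
  move=> u hu /=; rewrite -[LHS]mul1mx -id12 mulmxDl -!mulmxA.
  by rewrite (mulmxA R1) stab // mulmx0 add0r.
- by apply/row_freeP; exists L1.
- by apply/row_fullP; exists R2.
- apply/andP; split; first by rewrite sub_kermx R1L2.
  rewrite -[kermx L2]mulmx1 -id12 mulmxDr (mulmxA _ L2) mulmx_ker mul0mx addr0.
  by rewrite mulmxA submxMl.
Qed.

(** In a full rank factorization p = c r, the equation c r c r = c r can be cancelled on both sides
    to r c = 1. *)
Lemma idempotent_factor d (p : 'M[C]_d) : p *m p = p ->
  exists (k : nat) (R : 'M[C]_(k, d)) (L : 'M[C]_(d, k)),
    L *m R = p /\ R *m L = 1%:M.
Proof.
move=> pp; exists (\rank p), (row_base p), (col_base p).
split; first exact: mulmx_base.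
have /row_fullP[c' cc] := col_base_full p.
have /row_freeP[r' rr] := row_base_free p.
move: (\rank p) (col_base p) (row_base p) (mulmx_base p) c' cc r' rr.
move=> k c r crp c' cc r' rr.
move: pp; rewrite -crp => /(congr1 (fun A => c' *m A *m r')).
by rewrite !mulmxA cc !mul1mx -(mulmxA _ _ r') rr mulmx1.
Qed.

Lemma even_idempotent_factor a0 a1 (p : 'M[C]_(a0 + a1)) :
  phomog false p -> p *m p = p ->
  exists (k0 k1 : nat) (R : 'M[C]_(k0 + k1, a0 + a1)) (L : 'M[C]_(a0 + a1, k0 + k1)),
    [/\ phomog false R, phomog false L, L *m R = p & R *m L = 1%:M].
Proof.
move=> /(even_block_diag nz2) -> pp.
move: pp; rewrite mulmx_block !mulmx0 !mul0mx !addr0 !add0r.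
case/eq_block_mx=> p0 _ _ p1.
have [k0 [R0 [L0 [LR0 RL0]]]] := idempotent_factor p0.
have [k1 [R1 [L1 [LR1 RL1]]]] := idempotent_factor p1.
exists k0, k1, (block_mx R0 0 0 R1), (block_mx L0 0 0 L1).
rewrite !mulmx_block !mulmx0 !mul0mx !addr0 !add0r LR0 LR1 RL0 RL1.
by rewrite -scalar_mx_block; split=> //; apply/(even_mxP nz2);
  rewrite /even_mx block_mxKur block_mxKdl.
Qed.

End Grothendieck.

(** * Exchanging two adjacent coordinates *)

Section Quaternion.
Variables (C : fieldType) (d : nat) (A B : 'M[C]_d) (a b : C).
Hypotheses (AA : A *m A = a%:M) (BB : B *m B = b%:M) (BA : B *m A = - (A *m B)).

(** Elements of the generalized quaternion algebra of the pair, written on 1, A, B, A B. Identities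
    about the pair reduce to four scalar ones, left to [ring] and [field]. *)
Definition quat (x y z w : C) : 'M[C]_d :=
  x *: 1%:M + y *: A + z *: B + w *: (A *m B).

Lemma quatM x y z w x' y' z' w' :
  quat x y z w *m quat x' y' z' w' =
  quat (x * x' + a * y * y' + b * z * z' - a * b * w * w')
       (x * y' + y * x' - b * z * w' + b * w * z')
       (x * z' + z * x' + a * y * w' - a * w * y')
       (x * w' + w * x' + y * z' - z * y').
Proof.
have AAB : A *m (A *m B) = a *: B by rewrite mulmxA AA mul_scalar_mx.
have ABA : A *m B *m A = - a *: B by rewrite -mulmxA BA mulmxN AAB scaleNr.
have ABB : A *m B *m B = b *: A by rewrite -mulmxA BB mul_mx_scalar.
have BAB : B *m (A *m B) = - b *: A by rewrite mulmxA BA mulNmx ABB scaleNr.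
have ABAB : A *m B *m (A *m B) = - (a * b) *: 1%:M.
  by rewrite -mulmxA BAB -scalemxAr AA -(scalemx1 _ a) scalerA mulNr mulrC.
rewrite /quat !mulmxDl !mulmxDr -!scalemxAl -!scalemxAr !mul1mx !mulmx1.
rewrite AAB ABA ABB BAB ABAB AA BB BA -!(scalemx1 _ a) -!(scalemx1 _ b).
move: (A *m B) (1%:M : 'M[C]_d) => D I.
by apply/matrixP => k l; rewrite !mxE; ring.
Qed.

Lemma quatD x y z w x' y' z' w' :
  quat x y z w + quat x' y' z' w' = quat (x + x') (y + y') (z + z') (w + w').
Proof.
rewrite /quat; move: (A *m B) (1%:M : 'M[C]_d) => D I.
by apply/matrixP => k l; rewrite !mxE; ring.
Qed.

Lemma quatZ c x y z w :
  c *: quat x y z w = quat (c * x) (c * y) (c * z) (c * w).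
Proof. by rewrite /quat !scalerDr !scalerA. Qed.

Lemma quat_scalar x : x%:M = quat x 0 0 0.
Proof. by rewrite /quat !scale0r !addr0 scalemx1. Qed.

Lemma quat_l : A = quat 0 1 0 0.
Proof. by rewrite /quat !scale0r !addr0 add0r scale1r. Qed.

Lemma quat_r : B = quat 0 0 1 0.
Proof. by rewrite /quat !scale0r !addr0 !add0r scale1r. Qed.

Lemma quat0 : 0 = quat 0 0 0 0.
Proof. by rewrite /quat !scale0r !addr0. Qed.

Lemma quat_vec y z : quat 0 y z 0 = y *: A + z *: B.
Proof. by rewrite /quat !scale0r add0r addr0. Qed.

End Quaternion.

Section Swap.
Variables (C : fieldType) (n : nat).
Hypothesis nz2 : (2 : C) != 0.
Variables (s : 'I_n -> C) (M : smod C n) (i j : 'I_n).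
Hypotheses (MV : is_V s M) (ij : i != j).

Local Notation X_ M i := (act M (xi C i)).
Local Notation A := (X_ M i).
Local Notation B := (X_ M j).
Local Notation a := (s i).
Local Notation b := (s j).

Let MU : Umod M. Proof. by case: MV. Qed.
Let AA : A *m A = a%:M. Proof. exact: act_xi_sqr MV. Qed.
Let BB : B *m B = b%:M. Proof. exact: act_xi_sqr MV. Qed.
Let BA : B *m A = - (A *m B).
Proof. by rewrite act_xi_anticomm // eq_sym. Qed.

Section Family.
Variables (al be ga de : C).

(** The linear change A' = al A + be B, B' = ga A + de B. For the quadratic form a y^2 + b z^2, the
    conditions below make the new vectors orthogonal, with the two values exchanged and determinant
    1. *)
Definition pair_family (k : 'I_n) : 'M[C]_(d0 M + d1 M) :=
  if k == i then quat A B 0 al be 0 else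
  if k == j then quat A B 0 ga de 0 else X_ M k.

Hypothesis orth : al * ga * a + be * de * b = 0.
Hypothesis norm1 : al ^+ 2 * a + be ^+ 2 * b = b.
Hypothesis norm2 : ga ^+ 2 * a + de ^+ 2 * b = a.
Hypothesis det1 : al * de - be * ga = 1.

Lemma pair_family_i : pair_family i = quat A B 0 al be 0.
Proof. by rewrite /pair_family eqxx. Qed.

Lemma pair_family_j : pair_family j = quat A B 0 ga de 0.
Proof. by rewrite /pair_family eq_sym (negPf ij) eqxx. Qed.

Lemma pair_family_other k : k != i -> k != j -> pair_family k = X_ M k.
Proof. by rewrite /pair_family => /negPf -> /negPf ->. Qed.

Let quat_anticomm k y z : k != i -> k != j ->
  X_ M k *m quat A B 0 y z 0 = - (quat A B 0 y z 0 *m X_ M k).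
Proof.
move=> ki kj; rewrite quat_vec mulmxDr mulmxDl -!scalemxAr -!scalemxAl.
by rewrite (act_xi_anticomm MU ki) (act_xi_anticomm MU kj) !scalerN opprD.
Qed.

(** Orthogonality kills the scalar part of A' B', and the coefficient of A B is the determinant. *)
Lemma pair_family_ij :
  pair_family i *m pair_family j = quat A B 0 0 0 1.
Proof.
rewrite pair_family_i pair_family_j (quatM AA BB BA) -det1.
by congr quat; [rewrite -[RHS]orth|..]; ring.
Qed.

Lemma pair_family_ji :
  pair_family j *m pair_family i = quat A B 0 0 0 (-1).
Proof.
rewrite pair_family_i pair_family_j (quatM AA BB BA) -det1.
by congr quat; [rewrite -[RHS]orth|..]; ring.
Qed.

Lemma pair_family_anticomm k l : k != l ->
  pair_family k *m pair_family l = - (pair_family l *m pair_family k).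
Proof.
have ijN : pair_family i *m pair_family j = - (pair_family j *m pair_family i).
  by rewrite pair_family_ij pair_family_ji -scaleN1r quatZ; congr quat; ring.
have other k' l' : k' != l' -> k' != i -> k' != j ->
    pair_family k' *m pair_family l' = - (pair_family l' *m pair_family k').
  move=> kl ki kj; rewrite (pair_family_other ki kj) /pair_family.
  do 2![case: ifP => [_|_]; first exact: quat_anticomm].
  exact: act_xi_anticomm.
move=> kl; have [ki|ki] := eqVneq k i; last have [kj|kj] := eqVneq k j.
- rewrite ki in kl *; have [->//|lj] := eqVneq l j.
  by rewrite [in RHS]other ?opprK // eq_sym.
- rewrite kj in kl *; have [->|li] := eqVneq l i; first by rewrite ijN opprK.
  by rewrite [in RHS]other ?opprK // eq_sym.
- exact: other.
Qed.

Lemma pair_family_sqr k :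
  pair_family k *m pair_family k = (s (tperm i j k))%:M.
Proof.
have [->|ki] := eqVneq k i.
  rewrite tpermL pair_family_i (quatM AA BB BA) (quat_scalar A B).
  by rewrite -[in RHS]norm1; congr quat; ring.
have [->|kj] := eqVneq k j.
  rewrite tpermR pair_family_j (quatM AA BB BA) (quat_scalar A B).
  by rewrite -[in RHS]norm2; congr quat; ring.
by rewrite tpermD 1?eq_sym // pair_family_other // (act_xi_sqr _ MV).
Qed.

Lemma pair_family_odd k : phomog true (pair_family k).
Proof.
have hX l : phomog true (X_ M l) by apply: phomog_act_xi.
by rewrite /pair_family !quat_vec; do 2?case: ifP => _ //;
  apply: phomog_add; apply: phomog_scale.
Qed.

Lemma is_V_pair_family : is_V (fun k => s (tperm i j k)) (cmod pair_family).
Proof.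
have NU : Umod (cmod pair_family).
  exact: (cmod_Umod pair_family_odd pair_family_anticomm nz2).
split=> //; last by move=> k; rewrite act_xx // !cmod_xi pair_family_sqr.
case: MV => _ [dM MS] _; split=> // S0 S1 stab; apply: MS.
apply: stable_act => // k; set T := block_mx _ _ _ _ in stab *.
have Ti : (T *m pair_family i <= T)%MS by rewrite -cmod_xi.
have Tj : (T *m pair_family j <= T)%MS by rewrite -cmod_xi.
(* As the determinant is 1, A and B are combinations of the new pair, so subspaces stable under the
   new family are stable under the old one. *)
have lin x y : (T *m (x *: pair_family i + y *: pair_family j) <= T)%MS.
  by rewrite mulmxDr -!scalemxAr addmx_sub // scalemx_sub.
have [->|ki] := eqVneq k i.
  suff -> : A = de *: pair_family i + (- be) *: pair_family j by [].
  rewrite pair_family_i pair_family_j !quatZ quatD {1}[A](quat_l A B) -det1.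
  by congr quat; ring.
have [->|kj] := eqVneq k j.
  suff -> : B = (- ga) *: pair_family i + al *: pair_family j by [].
  rewrite pair_family_i pair_family_j !quatZ quatD {1}[B](quat_r A B) -det1.
  by congr quat; ring.
by rewrite -(pair_family_other ki kj) -cmod_xi.
Qed.

Lemma wfactor_quat_i k : wfactor M k i = quat A B a ((-1) ^+ k) 0 0.
Proof.
rewrite /wfactor AA (quat_scalar A B) {2}[A](quat_l A B) quatZ quatD.
by congr quat; ring.
Qed.

Lemma wfactor_quat_j k : wfactor M k j = quat A B b 0 ((-1) ^+ k) 0.
Proof.
rewrite /wfactor BB (quat_scalar A B) {2}[B](quat_r A B) quatZ quatD.
by congr quat; ring.
Qed.

Lemma wfactor_pair_i k : wfactor (cmod pair_family) k i =
  quat A B b ((-1) ^+ k * al) ((-1) ^+ k * be) 0.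
Proof.
rewrite /wfactor cmod_xi pair_family_sqr tpermL (quat_scalar A B) pair_family_i.
by rewrite quatZ quatD; congr quat; ring.
Qed.

Lemma wfactor_pair_j k : wfactor (cmod pair_family) k j =
  quat A B a ((-1) ^+ k * ga) ((-1) ^+ k * de) 0.
Proof.
rewrite /wfactor cmod_xi pair_family_sqr tpermR (quat_scalar A B) pair_family_j.
by rewrite quatZ quatD; congr quat; ring.
Qed.

End Family.

Variables (l1 l2 : seq 'I_n).
Hypothesis enumE : enum 'I_n = l1 ++ [:: i, j & l2].

(* The family is the unique solution of A' + B' = A + B and
   b B' - a A' = a B - b A. *)
Lemma swap_typical : a + b != 0 ->
  exists2 N, is_V (fun k => s (tperm i j k)) N & siso (@inW C n) M N.
Proof.
move=> ab.
pose al := 2 * b / (a + b); pose be := (b - a) / (a + b).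
pose ga := (a - b) / (a + b); pose de := 2 * a / (a + b).
have orth : al * ga * a + be * de * b = 0 by rewrite /al /ga /be /de; field.
have norm1 : al ^+ 2 * a + be ^+ 2 * b = b by rewrite /al /be; field.
have norm2 : ga ^+ 2 * a + de ^+ 2 * b = a by rewrite /ga /de; field.
have det1 : al * de - be * ga = 1 by rewrite /al /ga /be /de; field.
have NV := is_V_pair_family orth norm1 norm2 det1.
exists (cmod (pair_family al be ga de)) => //.
have NU : Umod (cmod (pair_family al be ga de)) by case: NV.
apply: siso_eq_act => //.
apply: (@inW_rel _ _ M (cmod (pair_family al be ga de)) (@eq _) l1 l2 i j) => //.
- by move=> ? ? ? ? -> ->.
- by move=> ? ? ? ->.
- by move=> ? ? ? ? -> ->.
- by move=> ? ? ->.
- by move=> k ki kj; rewrite cmod_xi pair_family_other.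
- move=> k; rewrite wfactor_quat_i wfactor_quat_j.
  rewrite wfactor_pair_i // wfactor_pair_j // !quatD.
  by congr quat; rewrite /al /be /ga /de; field.
- move=> k; rewrite wfactor_quat_i wfactor_quat_j wfactor_pair_i // wfactor_pair_j //.
  rewrite exprS mulN1r; move: ((-1) ^+ k) => e.
  rewrite !(quatM AA BB BA) /al /be /ga /de.
  congr quat; [| |by field..].
    by apply: (mulfI ab); field.
  by field.
Qed.

(* N is given by the pair (B, - A); p and q are the projections onto the
   eigenspaces of A B for the eigenvalues a and - a. *)
Lemma swap_atypical : a + b = 0 -> a != 0 ->
  exists2 N, is_V (fun k => s (tperm i j k)) N & K0eq M N.
Proof.
move=> ab a_neq0; have bE : b = - a by apply/eqP; rewrite -addr_eq0 addrC ab.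
have orth : 0 * -1 * a + 1 * 0 * b = 0 by ring.
have norm1 : 0 ^+ 2 * a + 1 ^+ 2 * b = b by ring.
have norm2 : (-1) ^+ 2 * a + 0 ^+ 2 * b = a by ring.
have det1 : 0 * 0 - 1 * -1 = 1 :> C by ring.
have NV := is_V_pair_family orth norm1 norm2 det1.
pose N := cmod (pair_family 0 1 (-1) 0).
exists N => //; have NU : Umod N by case: NV.
(* These are (1 + A B / a) / 2 and (1 - A B / a) / 2, idempotent because (A B)^2 = - a b = a^2. *)
pose p := quat A B 2^-1 0 0 (2 * a)^-1.
pose q := quat A B 2^-1 0 0 (- (2 * a)^-1).
have pq1 : p + q = 1%:M.
  by rewrite quatD (quat_scalar A B); congr quat; field; rewrite ?nz2 ?a_neq0.
have pp : p *m p = p.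
  by rewrite (quatM AA BB BA) bE; congr quat; field; rewrite ?nz2 ?a_neq0.
have qq : q *m q = q.
  by rewrite (quatM AA BB BA) bE; congr quat; field; rewrite ?nz2 ?a_neq0.
have pe : phomog false p.
  have hX l : phomog true (X_ M l) by apply: phomog_act_xi.
  rewrite /p /quat !scale0r !addr0; apply: phomog_add; apply: phomog_scale.
    exact: phomog_scalar.
  exact: (@phomog_mul _ _ _ _ _ _ _ true true).
have qe : phomog false q.
  have -> : q = 1%:M - p by rewrite -pq1 addrC addKr.
  by apply: phomog_sub => //; apply: phomog_scalar.
have [k0 [k1 [R1 [L1 [R1e L1e LR1 RL1]]]]] := even_idempotent_factor nz2 pe pp.
have [m0 [m1 [R2 [L2 [R2e L2e LR2 RL2]]]]] := even_idempotent_factor nz2 qe qq.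
have R1p : R1 *m p = R1 by rewrite -LR1 mulmxA RL1 mul1mx.
have R2q : R2 *m q = R2 by rewrite -LR2 mulmxA RL2 mul1mx.
have pL1 : p *m L1 = L1 by rewrite -LR1 -mulmxA RL1 mulmx1.
have qL2 : q *m L2 = L2 by rewrite -LR2 -mulmxA RL2 mulmx1.
(* Z preserves the image of p, Z' that of q, and their diagonal blocks coincide. This survives sums,
   products and, R and L being even, conjugation by the grading. *)
pose Rel (Z Z' : 'M[C]_(d0 M + d1 M)) :=
  [/\ R1 *m Z *m L2 = 0, R2 *m Z' *m L1 = 0,
      R1 *m Z *m L1 = R1 *m Z' *m L1 & R2 *m Z *m L2 = R2 *m Z' *m L2].
(* With p and q in place of R and L, the conditions can be computed in [quat] coordinates. *)
have Rel_pq (Z Z' : 'M[C]_(d0 M + d1 M)) : p *m Z *m q = 0 -> q *m Z' *m p = 0 ->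
    p *m Z *m p = p *m Z' *m p -> q *m Z *m q = q *m Z' *m q -> Rel Z Z'.
  have corner m m' (R : 'M[C]_(m, d0 M + d1 M)) (L : 'M_(d0 M + d1 M, m')) r l :
      R *m r = R -> l *m L = L ->
      forall Z0, R *m Z0 *m L = R *m (r *m Z0 *m l) *m L.
    by move=> hR hL Z0; rewrite -{1}hR -{1}hL !mulmxA.
  move=> h1 h2 h3 h4; split.
  - by rewrite (corner _ _ _ _ _ _ R1p qL2) h1 mulmx0 mul0mx.
  - by rewrite (corner _ _ _ _ _ _ R2q pL1) h2 mulmx0 mul0mx.
  - by rewrite (corner _ _ _ _ _ _ R1p pL1 Z) h3 -(corner _ _ _ _ _ _ R1p pL1).
  - by rewrite (corner _ _ _ _ _ _ R2q qL2 Z) h4 -(corner _ _ _ _ _ _ R2q qL2).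
have ins m m' (Z : 'M_(m, _)) (Z' : 'M_(_, m')) :
    Z *m Z' = Z *m L1 *m (R1 *m Z') + Z *m L2 *m (R2 *m Z').
  by rewrite -{1}[Z]mulmx1 -pq1 -LR1 -LR2 mulmxDr mulmxDl !mulmxA.
have Rel_act u : inW u -> Rel (act M u) (act N u).
  apply: (@inW_rel _ _ M N Rel l1 l2 i j) => //.
  - by apply: Rel_pq; rewrite !mulmx1 ?pp ?qq // (quatM AA BB BA) (quat0 A B) bE;
      congr quat; field; rewrite ?nz2 ?a_neq0.
  - move=> Z Z' Y Y' [z1 z2 z3 z4] [y1 y2 y3 y4].
    by split; rewrite !(mulmxDr, mulmxDl) ?z1 ?y1 ?z2 ?y2 ?z3 ?y3 ?z4 ?y4 ?addr0.
  - move=> c Z Z' [z1 z2 z3 z4].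
    by split; rewrite -!scalemxAr -!scalemxAl ?z1 ?z2 ?z3 ?z4 ?scaler0.
  - move=> Z Z' Y Y' [z1 z2 z3 z4] [y1 y2 y3 y4].
    have e k l (R : 'M_(k, _)) (L : 'M_(_, l)) Z0 Y0 : R *m (Z0 *m Y0) *m L =
        R *m Z0 *m L1 *m (R1 *m Y0 *m L) + R *m Z0 *m L2 *m (R2 *m Y0 *m L).
      by rewrite !(mulmxA R) -[LHS]mulmxA ins !(mulmxA _ Y0 L).
    by split; rewrite !e ?z1 ?z2 ?y1 ?y2 ?mul0mx ?mulmx0 ?addr0 ?add0r
       ?z3 ?z4 ?y3 ?y4.
  - move=> Z Z' [z1 z2 z3 z4].
    have conj k k' l l' (R : 'M_(k + k', _)) (L : 'M_(_, l + l')) Z0 :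
        phomog false R -> phomog false L ->
        R *m (gradmx C _ _ *m Z0 *m gradmx C _ _) *m L =
        gradmx C _ _ *m (R *m Z0 *m L) *m gradmx C _ _.
      rewrite /phomog !scale1r => hR hL.
      by rewrite -!mulmxA hL !mulmxA hR.
    by split; rewrite !conj // ?z1 ?z2 ?z3 ?z4 ?mulmx0 ?mul0mx.
  - move=> k ki kj; rewrite cmod_xi pair_family_other //.
    (* X_k anticommutes with both A and B, hence commutes with A B, p and q. *)
    have comm w : quat A B 2^-1 0 0 w *m X_ M k = X_ M k *m quat A B 2^-1 0 0 w.
      rewrite /quat !scale0r !addr0 mulmxDr mulmxDl -!scalemxAr -!scalemxAl.
      rewrite mul1mx mulmx1; congr (_ + _ *: _).
      rewrite [RHS]mulmxA (act_xi_anticomm MU ki) mulNmx -[in RHS]mulmxA.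
      by rewrite (act_xi_anticomm MU kj) mulmxN opprK mulmxA.
    have pq0 : p *m q = 0.
      by rewrite (quatM AA BB BA) (quat0 A B) bE; congr quat; field;
        rewrite ?nz2 ?a_neq0.
    have qp0 : q *m p = 0.
      by rewrite (quatM AA BB BA) (quat0 A B) bE; congr quat; field;
        rewrite ?nz2 ?a_neq0.
    by apply: Rel_pq => //; rewrite comm -mulmxA ?pq0 ?qp0 mulmx0.
  - move=> k; rewrite wfactor_quat_i wfactor_quat_j.
    rewrite wfactor_pair_i // wfactor_pair_j // !quatD bE.
    by apply: Rel_pq; rewrite !(quatM AA BB BA) ?(quat0 A B) bE; congr quat;
      field; rewrite ?nz2 ?a_neq0.
  - move=> k; rewrite wfactor_quat_i wfactor_quat_j wfactor_pair_i // wfactor_pair_j //.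
    rewrite exprS mulN1r; move: ((-1) ^+ k) => e.
    rewrite !(quatM AA BB BA) bE.
    by apply: Rel_pq; rewrite !(quatM AA BB BA) ?(quat0 A B) bE; congr quat;
      field; rewrite ?nz2 ?a_neq0.
have sum12 : L1 *m R1 + L2 *m R2 = 1%:M by rewrite LR1 LR2.
have ses1 : Wses (compress R1 L1) M (compress R2 L2).
  apply: Wses_compress => //; first exact: Umod_Wmod.
  by move=> u /Rel_act[].
have ses2 : Wses (@compress _ _ N _ _ R2 L2) N (@compress _ _ N _ _ R1 L1).
  apply: Wses_compress => //; first exact: Umod_Wmod.
    by rewrite addrC.
  by move=> u /Rel_act[].
have iso1 : siso (@inW C n) (compress R1 L1) (@compress _ _ N _ _ R1 L1).
  by apply: siso_eq_act => // u /Rel_act[].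
have iso2 : siso (@inW C n) (compress R2 L2) (@compress _ _ N _ _ R2 L2).
  by apply: siso_eq_act => // u /Rel_act[].
(* The relations [M] = [K] + [Q] and [N] = [Q] + [K] are taken with coefficients 1 and -1; the terms
   in K and Q cancel by [iso1] and [iso2]. *)
pose pick T (x y : T) (t : 'I_2) := if t == 0 then x else y.
exists 2%N, (pick _ 1 (-1)), (pick _ (compress R1 L1) (@compress _ _ N _ _ R2 L2)),
  (pick _ M N), (pick _ (compress R2 L2) (@compress _ _ N _ _ R1 L1)).
split; first by move=> t; rewrite /pick; case: ifP.
move=> X _; rewrite !big_ord_recl big_ord0 /pick /= (indW_siso nz2 X iso1).
by rewrite (indW_siso nz2 X iso2); ring.
Qed.

End Swap.

(** * From adjacent transpositions to all permutations *)

Section Permutations.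
Variables (C : fieldType) (n : nat).
Hypothesis nz2 : (2 : C) != 0.
Implicit Types (s : 'I_n -> C) (M N : smod C n).

(** Asking for some N, with no parity choice, makes the property composable; [Pi] enters only once,
    when N is compared with a given module. *)
Definition permutable (sigma : 'S_n) := forall s M, is_V s M ->
  exists N, [/\ is_V (fun k => s (sigma k)) N, K0eq M N &
                typical s -> siso (@inW C n) M N].

Lemma is_V_ext s s' M : s =1 s' -> is_V s M -> is_V s' M.
Proof. by move=> ss' [MU MS Ms]; split=> // i; rewrite -ss'. Qed.

Lemma siso_refl (A : Uh C n -> Prop) M : siso A M M.
Proof.
exists 1%:M, 1%:M; rewrite mulmx1; split=> //; split.
  by apply/even_mxP => //; apply: phomog_scalar.
by move=> u _; rewrite mulmx1 mul1mx.
Qed.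

Lemma permutable1 : permutable 1.
Proof.
move=> s M MV; exists M; split; last by move=> _; apply: siso_refl.
  by apply: is_V_ext MV => k; rewrite perm1.
by apply: K0eq_siso => //; apply: siso_refl.
Qed.

Lemma permutableM (sigma tau : 'S_n) :
  permutable sigma -> permutable tau -> permutable (sigma * tau).
Proof.
(* The product sends k to tau (sigma k), so s is composed with tau first. *)
move=> hs ht s M /ht[N [NV MN tMN]]; have [L [LV NL tNL]] := hs _ _ NV.
exists L; split.
- by apply: is_V_ext LV => k; rewrite permM.
- exact: K0eq_trans NL.
- move=> ts; apply: siso_trans (tMN ts) (tNL _) => // i j ij.
  by apply: ts; rewrite (inj_eq perm_inj).
Qed.

Lemma enum_ord_adjacent (i j : 'I_n) : j = i.+1 :> nat ->
  exists l1 l2, enum 'I_n = l1 ++ [:: i, j & l2].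
Proof.
move=> ji; exists (take i (enum 'I_n)), (drop j.+1 (enum 'I_n)).
have dropE (k : 'I_n) : drop k (enum 'I_n) = k :: drop k.+1 (enum 'I_n).
  by rewrite (drop_nth k) ?size_enum_ord // nth_ord_enum.
by rewrite -{1}(cat_take_drop i (enum 'I_n)) dropE -ji dropE.
Qed.

Lemma permutable_adjacent (i j : 'I_n) : j = i.+1 :> nat ->
  permutable (tperm i j).
Proof.
move=> ji s M MV; have [l1 [l2 enumE]] := enum_ord_adjacent ji.
have ij : i != j by rewrite -val_eqE /= ji ltn_eqF.
have [ab|ab] := eqVneq (s i + s j) 0; last first.
  have [N NV MN] := swap_typical nz2 MV ij enumE ab.
  by exists N; split=> //; apply: K0eq_siso.
have natyp : ~ typical s by move/(_ i j ij); rewrite ab eqxx.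
have [a0|a_neq0] := eqVneq (s i) 0; last first.
  by have [N NV MN] := swap_atypical nz2 MV ij enumE ab a_neq0; exists N.
(* Both coordinates are 0, so exchanging them changes nothing and M itself serves. *)
exists M; split=> //; last by apply: K0eq_siso => //; apply: siso_refl.
apply: is_V_ext MV => k; have b0 : s j = 0 by rewrite a0 add0r in ab.
by case: tpermP => [->|->|//]; rewrite a0 b0.
Qed.

Lemma permutable_tperm (i j : 'I_n) : permutable (tperm i j).
Proof.
wlog lt_ij : i j / (i < j)%N => [hw|].
  case: (ltngtP i j) => [h|h|/val_inj ->]; first exact: hw.
    by rewrite tpermC; apply: hw.
  by rewrite tperm1; apply: permutable1.
have [m] := ubnP (j - i)%N; elim: m i j lt_ij => // m IH i j lt_ij le_m.
have [ji|ji] := eqVneq (j : nat) i.+1; first exact: permutable_adjacent.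
have kn : (j.-1 < n)%N by rewrite (leq_ltn_trans (leq_pred j)).
pose k := Ordinal kn.
have jk : j = k.+1 :> nat by rewrite /= prednK // (leq_ltn_trans _ lt_ij).
have lt_ik : (i < k)%N by rewrite -ltnS -jk ltn_neqAle eq_sym ji.
(* Conjugating (i k) by the adjacent (k j), with k = j - 1, gives (i j), and k - i is smaller by
   one. *)
have -> : tperm i j = (tperm k j * tperm i k * tperm k j)%g.
  rewrite -{1}(tpermV k j) -mulgA -conjgE tpermJ tpermL tpermD //.
    by rewrite -val_eqE /= gtn_eqF.
  by rewrite -val_eqE /= gtn_eqF.
have adj := permutable_adjacent jk.
apply: (permutableM _ adj); apply: (permutableM adj); apply: IH => //.
by rewrite -ltnS (leq_trans _ le_m) // ltnS jk subSn // ltnW.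
Qed.

Lemma permutable_perm (sigma : 'S_n) : permutable sigma.
Proof.
have [ts -> _] := prod_tpermP sigma.
by elim/big_ind: _ => [||t _]; [apply: permutable1|apply: permutableM|
  apply: permutable_tperm].
Qed.

End Permutations.

(* C = R[i] for R : realType (the complex numbers) *)
Theorem theorem4p4 (R : realType) (n : nat) (hn : (1 <= n)%N)
    (s : 'I_n -> R[i]) (sigma : 'S_n) :
  let s' := fun i => s (sigma i) in
  (typical s ->
     forall M M' : smod R[i] n, is_V s M -> is_V s' M' ->
       siso (@inW R[i] n) M M' \/ siso (@inW R[i] n) M (Pi M')) /\
  (forall M M' : smod R[i] n, is_V s M -> is_V s' M' ->
       K0eq M M' \/ K0eq M (Pi M')).
Proof.
move=> s'; have nz2 : (2 : R[i]) != 0 by rewrite pnatr_eq0.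
(* The module reached from M and the given M' are both a V(s'), hence isomorphic up to parity. *)
have uniq_W N M' : is_V s' N -> is_V s' M' ->
    siso (@inW R[i] n) N M' \/ siso (@inW R[i] n) N (Pi M').
  by move=> NV MV'; case: (is_V_unique nz2 NV MV') => h; [left|right];
    apply: siso_sub h.
split=> [ts|] M M' MV MV'; have [N [NV MN tMN]] := permutable_perm nz2 sigma MV.
  by case: (uniq_W _ _ NV MV') => h; [left|right]; apply: siso_trans h => //;
    apply: tMN.
by case: (uniq_W _ _ NV MV') => h; [left|right]; apply: K0eq_trans MN _;
  apply: K0eq_siso.
Qed.
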